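(* Let $1\le i\le n$, let $w\in W^i$ and let $\underline\ell_w=(\ell_1\le\dots\le\ell_i)$ be the associated sequence, with $\ell_0:=i-1$. Then the order polytope $\mathcal O_{\underline\ell_w}$ and the chain polytope $\mathcal C_{\underline\ell_w}$ are Gorenstein polytopes if and only if there exists $K$ such that for all $j=1,\dots,i$: $$\ell_j-j=K\quad\text{or}\quad\ell_j=\ell_{j-1}.$$
   Context: $W=S_{n+1}$ is the Weyl group of $\mathfrak{sl}_{n+1}$, with positive roots $\alpha_{k,j}=\alpha_k+\dots+\alpha_j$ ($1\le k\le j\le n$), $R^\pm$ the positive/negative roots. $W^i=S_{n+1}/(S_i\times S_{n+1-i})$, cosets being identified with minimal length representatives. For $w\in W^i$ and $1\le k\le i$, $\ell_k=\max(\{i-1\}\cup\{j\mid i\le j\le n,\ \alpha_{k,j}\in w^{-1}(R^-)\cap R^+\})$. $\mathcal P_{\underline\ell}$ is the poset with elements $x_{k,j}$, $1\le k\le i$, $i\le j\le\ell_k$, and $x_{k_1,j_1}\ge x_{k_2,j_2}$ iff $k_1\le k_2$ and $j_1\ge j_2$; $N$ is its number of elements. The order polytope is $\mathcal O_{\underline\ell}=\{(s_{k,j})\in[0,1]^N\mid s_{k_1,j_1}\ge s_{k_2,j_2}\text{ if }x_{k_1,j_1}>x_{k_2,j_2}\}$ and the chain polytope is $\mathcal C_{\underline\ell}=\{(s_{k,j})\in\mathbb R_{\ge0}^N\mid\sum_p s_{k_p,j_p}\le1\text{ for all chains }x_{k_1,j_1}>\dots>x_{k_s,j_s}\}$. A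 lattice polytope is Gorenstein if some integer dilation of it is, up to translation by a lattice vector, a reflexive polytope. *)

(* Defs.v *)
From HB Require Import structures.
From mathcomp Require Import all_boot all_order all_fingroup all_algebra.
From mathcomp Require Import all_classical all_reals all_analysis.
From mathcomp Require Import zify.

Set Implicit Arguments.
Unset Strict Implicit.
Unset Printing Implicit Defensive.

Import Order.TTheory GRing.Theory Num.Theory.
Import numFieldNormedType.Exports.
Local Open Scope ring_scope.

(* The Weyl group W = S_{n+1} is ['S_n.+1].  Labels of roots and of poset     *)
(* elements are 1-based as usual in type A_n; the letter a in {1,...,n+1} is  *)
(* the ordinal of value a - 1.  Beware that [(u * w)%g] is "u, then w", i.e.  *)
(* the product usually written w u.                                           *)

Definition simple_refl (n : nat) (k : 'I_n) : 'S_n.+1 :=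
  tperm (inord k) (inord k.+1).

Definition word_prod (n : nat) (s : seq 'I_n) : 'S_n.+1 :=
  (\prod_(k <- s) simple_refl k)%g.

Definition is_word_length (n : nat) (w : 'S_n.+1) (r : nat) : bool :=
  [exists t : r.-tuple 'I_n, word_prod t == w].

Lemma word_prod_cat (n : nat) (s t : seq 'I_n) :
  word_prod (s ++ t) = (word_prod s * word_prod t)%g.
Proof. by rewrite /word_prod big_cat. Qed.

Lemma tperm_word (n : nat) (d a : nat) : (a + d < n.+1)%N ->
  exists s : seq 'I_n,
    word_prod s = tperm (inord a) (inord (a + d)) :> 'S_n.+1.
Proof.
elim: d => [|d IHd] had.
  by exists [::]; rewrite /word_prod big_nil addn0 tperm1.
have [|s hs] := IHd; first by apply: leq_trans had; rewrite ltnS leq_add2l.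
have hn : (a + d < n)%N by rewrite addnS in had.
have eqI (x y : nat) : (x < n.+1)%N -> (y < n.+1)%N ->
    ((inord x : 'I_n.+1) == inord y) = (x == y).
  by move=> hx hy; rewrite -val_eqE /= !inordK.
case: (posnP d) => [d0|d_gt0].
  exists [:: Ordinal hn].
  by rewrite /word_prod big_seq1 /simple_refl /= d0 addn0 addn1.
exists (Ordinal hn :: s ++ [:: Ordinal hn]).
rewrite -cat1s !word_prod_cat hs /word_prod big_seq1 /simple_refl /= addnS.
set t := tperm (inord (a + d)) _.
have -> : (t * (tperm (inord a) (inord (a + d)) * t) = tperm (inord a) (inord (a + d)) ^ t)%g.
  by rewrite conjgE /t tpermV.
by rewrite tpermJ /t tpermL tpermD ?eqI -?addnS //; lia.
Qed.

Lemma has_word_length (n : nat) (w : 'S_n.+1) :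
  exists r, is_word_length w r.
Proof.
suff [s hs] : exists s : seq 'I_n, word_prod s = w.
  by exists (size s); apply/existsP; exists (in_tuple s); apply/eqP.
have [ts -> _] := prod_tpermP w.
elim: ts => [|[x y] ts [s IH]]; first by exists [::]; rewrite /word_prod !big_nil.
suff [s' hs'] : exists s' : seq 'I_n, word_prod s' = tperm x y.
  by exists (s' ++ s); rewrite word_prod_cat hs' IH big_cons.
wlog le_xy : x y / (x <= y)%N => [hw|].
  by case: (leqP x y) => [|/ltnW] /hw // [s' ?]; exists s'; rewrite tpermC.
have [|s' hs'] := @tperm_word n (y - x) x; first by rewrite subnKC.
by exists s'; rewrite hs' subnKC // !inord_val.
Qed.

Definition coxeter_length (n : nat) (w : 'S_n.+1) : nat :=
  ex_minn (has_word_length w).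

(* S_i x S_{n+1-i}: permutations preserving the set of the first i letters. *)
Definition parabolic (n i : nat) : {set 'S_n.+1} :=
  [set u : 'S_n.+1 | [forall a, (u a < i)%N == (a < i)%N]].

(* W^i: w has minimal length in the coset w (S_i x S_{n+1-i}). *)
Definition min_coset_reps (n i : nat) : {set 'S_n.+1} :=
  [set w | [forall u in parabolic n i,
              coxeter_length w <= coxeter_length (u * w)%g]%N].

Definition eps (n a : nat) : 'rV[int]_n.+1 := \row_b ((b.+1 == a)%:R).

Definition simple_root (n k : nat) : 'rV[int]_n.+1 := eps n k - eps n k.+1.

Definition alpha (n k j : nat) : 'rV[int]_n.+1 :=
  \sum_(k <= m < j.+1) simple_root n m.

Definition pos_root (n : nat) : pred 'rV[int]_n.+1 :=
  fun v => [exists k : 'I_n, exists j : 'I_n,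
              (k <= j)%N && (v == alpha n k.+1 j.+1)].

Definition neg_root (n : nat) : pred 'rV[int]_n.+1 := fun v => pos_root (- v).

(* The action w (eps_a) = eps_{w(a)}. *)
Definition weyl_act (n : nat) (w : 'S_n.+1) (v : 'rV[int]_n.+1) :
  'rV[int]_n.+1 := \row_b v 0 (w^-1%g b).

(* w^{-1}(R^-) /\ R^+: the positive roots v such that w(v) is negative. *)
Definition inversion_root (n : nat) (w : 'S_n.+1) : pred 'rV[int]_n.+1 :=
  fun v => neg_root (weyl_act w v) && pos_root v.

(* The sequence l_1, ..., l_i, preceded by l_0 = i - 1. *)
Definition ell (n i : nat) (w : 'S_n.+1) (k : nat) : nat :=
  if k == 0%N then i.-1
  else maxn i.-1 (\max_(i <= j < n.+1 | inversion_root w (alpha n k j)) j).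

(* The pair (k, j), ordinals taken at their actual value, stands for x_{k,j}, *)
(* with 1 <= k <= i and i <= j <= l_k.  The bound j <= n, needed to have a    *)
(* finite type, is no restriction for l = ell i w.                            *)
Definition Pell (n i : nat) (l : nat -> nat) : Type :=
  {x : 'I_i.+1 * 'I_n.+1 | (1 <= x.1)%N && (i <= x.2 <= l x.1)%N}.

HB.instance Definition _ n i l := Finite.on (@Pell n i l).

Definition Pell_le n i l (x y : @Pell n i l) : bool :=
  ((val y).1 <= (val x).1)%N && ((val x).2 <= (val y).2)%N.

Lemma Pell_le_refl n i l : reflexive (@Pell_le n i l).
Proof. by move=> x; rewrite /Pell_le !leqnn. Qed.

Lemma Pell_le_anti n i l : antisymmetric (@Pell_le n i l).
Proof.
move=> x y /andP[/andP[h1 h2] /andP[h3 h4]]; apply/val_inj.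
rewrite [val x]surjective_pairing [val y]surjective_pairing.
by congr (_, _); apply/val_inj/eqP; rewrite eqn_leq ?h1 ?h2 ?h3 ?h4.
Qed.

Lemma Pell_le_trans n i l : transitive (@Pell_le n i l).
Proof.
move=> y x z /andP[h1 h2] /andP[h3 h4].
by rewrite /Pell_le (leq_trans h3 h1) (leq_trans h2 h4).
Qed.

Fact Pell_display : Order.disp_t. Proof. exact: Order.Disp tt tt. Qed.

HB.instance Definition _ n i l :=
  Order.Le_isPOrder.Build Pell_display (@Pell n i l)
    (@Pell_le_refl n i l) (@Pell_le_anti n i l) (@Pell_le_trans n i l).

(* A point of R^N, N = #|P|, has one coordinate for each element of P. *)
Definition coord (R : Type) (P : finType) (s : 'rV[R]_#|P|) (x : P) : R :=
  s ord0 (enum_rank x).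

Definition order_polytope (R : realType) (d : Order.disp_t)
    (P : finPOrderType d) : set 'rV[R]_#|P| :=
  [set s | (forall x : P, 0 <= coord s x <= 1) /\
           (forall x y : P, (x > y)%O -> coord s x >= coord s y)]%classic.

Definition chain_polytope (R : realType) (d : Order.disp_t)
    (P : finPOrderType d) : set 'rV[R]_#|P| :=
  [set s | (forall x : P, 0 <= coord s x) /\
           (forall c : seq P, sorted >%O c ->
              \sum_(x <- c) coord s x <= 1)]%classic.

Definition conv_hull (R : realType) (N m : nat) (v : 'I_m -> 'rV[R]_N) :
    set 'rV[R]_N :=
  [set s | exists c : 'I_m -> R,
     [/\ forall a, 0 <= c a, \sum_a c a = 1 & s = \sum_a c a *: v a]]%classic.

Definition lattice_pt (R : realType) (N : nat) (z : 'rV[int]_N) : 'rV[R]_N :=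
  map_mx intr z.

Definition lattice_polytope (R : realType) (N : nat) (A : set 'rV[R]_N) : Prop :=
  exists (m : nat) (z : 'I_m -> 'rV[int]_N),
    A = conv_hull (fun a => lattice_pt R (z a)).

(* R^N is identified with its dual, and Z^N with the dual lattice, by the     *)
(* standard scalar product.                                                   *)
Definition polar_dual (R : realType) (N : nat) (A : set 'rV[R]_N) :
    set 'rV[R]_N :=
  [set y | forall s, A s -> \sum_a s ord0 a * y ord0 a <= 1]%classic.

Definition reflexive_polytope (R : realType) (N : nat) (A : set 'rV[R]_N) :
    Prop :=
  [/\ lattice_polytope A, interior A 0 & lattice_polytope (polar_dual A)].

Definition gorenstein (R : realType) (N : nat) (A : set 'rV[R]_N) : Prop :=
  lattice_polytope A /\
  exists (m : nat) (z : 'rV[int]_N), (0 < m)%N /\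
    reflexive_polytope [set m%:R *: s + lattice_pt R z | s in A]%classic.

(* Main.v *)
Require Import Defs.
From mathcomp Require Import all_boot all_order all_fingroup all_algebra.
From mathcomp Require Import all_classical all_reals all_analysis.
From mathcomp Require Import zify ring lra.

(** Both order and chain polytopes of a finite poset are Gorenstein exactly when
the poset is pure, that is, when all its maximal chains have the same number of
elements (Stanley, Hibi).  The poset of the sequence l, if not empty, has the
unique minimal element x_{i,i}; it is ranked by j - k + 1, and its maximal
elements are the corners x_{k,l_k} with l_k <> l_{k-1}.  Hence purity says that
l_k - k is the same for all corners, which is the criterion
([equirank_criterion]).

Necessity of purity rests on the fact that the facets of a reflexive polytope
lie at lattice distance one from the origin ([reflexive_facet]): the facet
functional, scaled so as to be 1 on the facet, is a convex combination of
lattice points of the polar dual, and each of these that has a positive weight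
is also 1 on the facet, hence is itself proportional to the functional.  Let
the dilation by m and the translation by z make the polytope reflexive.
For the order polytope, the facets given by the minimal elements and by the
coverings force z to be the opposite of the rank, and the facet of a maximal
element then forces its rank to be m - 1.  For the chain polytope, the
coordinate facets force all entries of z to be -1, and the facet of a maximal
chain forces it to have m - 1 elements.

For sufficiency, if all maximal elements have rank L then dilating by L + 1 and
translating by the opposite of the rank, resp. by the vector with all entries
-1, turns all the facet inequalities into inequalities <a, s> <= 1 with
integral a.  By Farkas' lemma ([farkas], [affine_farkas]) the polar dual is then
the convex hull of 0 and of the vectors a ([polar_dual_lattice]).  That the two
polytopes are lattice polytopes is shown by writing a point as a combination of
indicators of up-sets, resp. antichains, peeling off one after the other
([decompose_by_peeling]).

The Weyl group element enters only through the monotonicity of l: a minimal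
coset representative is increasing on the first i letters, because otherwise
the exchange property ([word_exchange]) would shorten it within its coset. *)

Set Implicit Arguments.
Unset Strict Implicit.
Unset Printing Implicit Defensive.

Import Order.TTheory GRing.Theory Num.Theory.
Import numFieldNormedType.Exports.
Local Open Scope ring_scope.

Local Notation coord := Defs.coord.
Local Notation set0 := finset.set0.

(** * Minimal coset representatives and the sequence l *)

Lemma simple_refl_flip n (k : 'I_n) (x y : 'I_n.+1) :
  (x < y)%N -> (simple_refl k y <= simple_refl k x)%N ->
  tperm x y = simple_refl k.
Proof.
have hk := ltn_ord k; rewrite /simple_refl.
set p := inord k; set q := inord k.+1.
have hp : p = k :> nat by rewrite inordK // ltnW.
have hq : q = k.+1 :> nat by rewrite inordK.
have tpE (c : 'I_n.+1) : tperm p q c = 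
    (if c == k :> nat then k.+1 : nat
     else if c == k.+1 :> nat then k : nat else c) :> nat.
  rewrite -{1}hp -{2}hq !val_eqE.
  by case: tpermP => [->|->|/eqP/negPf-> /eqP/negPf->];
     rewrite ?eqxx // -?val_eqE /= ?hp ?hq ?gtn_eqF.
rewrite !tpE => lt_xy le_yx.
have [def_x def_y] : x = k :> nat /\ y = k.+1 :> nat.
  by move: lt_xy le_yx; case: (x =P k :> nat); case: (x =P k.+1 :> nat);
     case: (y =P k :> nat); case: (y =P k.+1 :> nat); lia.
by congr tperm; apply: val_inj; rewrite /= ?hp ?hq.
Qed.

(** Reading the letters of a word one by one moves the pair x < y around; at
some letter it becomes inverted, which means that this letter swaps the two
current neighbours.  Deleting it amounts to multiplying by the transposition of
x and y. *)
Lemma word_exchange n (t : seq 'I_n) (x y : 'I_n.+1) :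
  (x < y)%N -> (word_prod t y < word_prod t x)%N ->
  exists2 t', (size t' < size t)%N
            & word_prod t' = (tperm x y * word_prod t)%g.
Proof.
elim: t x y => [|k t IH] x y lt_xy.
  by rewrite /word_prod big_nil !perm1 ltnNge ltnW.
rewrite -cat1s word_prod_cat {1 3}/word_prod big_seq1 !permM => lt_wyx.
have [lt_s|le_s] := ltnP (simple_refl k x) (simple_refl k y).
  have [t' lt_t' def_t'] := IH _ _ lt_s lt_wyx.
  exists (k :: t'); first by rewrite /= ltnS.
  rewrite -cat1s !word_prod_cat def_t' !mulgA; congr (_ * _)%g.
  by rewrite {1 2}/word_prod big_seq1 -tpermJ conjgE !mulgA mulgV mul1g.
exists t => //; rewrite {2}/word_prod big_seq1.
by rewrite (simple_refl_flip lt_xy le_s) mulgA tperm2 mul1g.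
Qed.

(** The transposition of a and b lies in the parabolic subgroup, so an inversion
of w at a, b < i would yield a shorter element of the coset. *)
Lemma min_coset_rep_incr n i (w : 'S_n.+1) (a b : 'I_n.+1) :
  w \in min_coset_reps n i -> (a < b < i)%N -> (w a < w b)%N.
Proof.
rewrite inE => /forall_inP w_min /andP[lt_ab lt_bi].
rewrite ltn_neqAle val_eqE (inj_eq perm_inj) -val_eqE /= ltn_eqF //= leqNgt.
apply/negP => lt_w.
have u_par : tperm a b \in parabolic n i.
  rewrite inE; apply/forallP => c; apply/eqP.
  by case: tpermP => [->|->|] //; rewrite lt_bi (ltn_trans lt_ab).
have := w_min _ u_par; rewrite leqNgt => /negP; apply.
rewrite {2}/coxeter_length; case: ex_minnP => r /existsP[t /eqP def_w] _.
rewrite -def_w in lt_w *.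
have [t' lt_t' def_t'] := word_exchange lt_ab lt_w.
rewrite size_tuple in lt_t'.
rewrite /coxeter_length; case: ex_minnP => r' _ r'_min.
apply: leq_ltn_trans lt_t'; apply: r'_min.
by apply/existsP; exists (in_tuple t'); rewrite def_t'.
Qed.

Lemma alpha_eps n k j : (k <= j)%N -> alpha n k j = eps n k - eps n j.+1.
Proof.
move=> le_kj; rewrite /alpha /simple_root -[RHS]opprB.
rewrite -(@telescope_sumr _ k j.+1 (eps n)) ?leqW // -sumrN.
by apply: eq_bigr => a _; rewrite opprB.
Qed.

Lemma weyl_act_eps n (w : 'S_n.+1) (a : 'I_n.+1) :
  weyl_act w (eps n a.+1) = eps n (w a).+1.
Proof.
apply/rowP => b; rewrite !mxE !eqSS !val_eqE.
by rewrite -(inj_eq (@perm_inj _ w)) permKV.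
Qed.

Lemma weyl_actB n (w : 'S_n.+1) u v :
  weyl_act w (u - v) = weyl_act w u - weyl_act w v.
Proof. by apply/rowP => b; rewrite !mxE. Qed.

Lemma pos_root_eps n (a b : 'I_n.+1) :
  pos_root (eps n a.+1 - eps n b.+1) = (a < b)%N.
Proof.
apply/existsP/idP => [[k /existsP[j /andP[le_kj /eqP]]]|lt_ab].
  rewrite alpha_eps //; have hk := ltn_ord k; have hj := ltn_ord j.
  have hk1 : (k < n.+1)%N by lia.
  have hj1 : (j.+1 < n.+1)%N by lia.
  move=> /rowP E; move: (E (Ordinal hk1)) (E (Ordinal hj1)).
  rewrite !mxE /= !eqSS !eqxx.
  by case: (k =P a :> nat); case: (k =P b :> nat); case: (k =P j.+1 :> nat);
     case: (j.+1 =P a :> nat); case: (j.+1 =P b :> nat);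
     case: (j.+1 =P k :> nat); lia.
have hb := ltn_ord b.
have ha : (a < n)%N by lia.
have hb' : (b.-1 < n)%N by lia.
exists (Ordinal ha); apply/existsP; exists (Ordinal hb') => /=.
by rewrite alpha_eps prednK ?eqxx ?andbT //; lia.
Qed.

Lemma inversion_rootE n (w : 'S_n.+1) (a b : 'I_n.+1) : (a < b)%N ->
  inversion_root w (alpha n a.+1 b) = (w b < w a)%N.
Proof.
move=> lt_ab; rewrite alpha_eps // /inversion_root pos_root_eps lt_ab andbT.
by rewrite weyl_actB !weyl_act_eps /neg_root opprB pos_root_eps.
Qed.

Lemma ell_ge n i (w : 'S_n.+1) k : (i.-1 <= ell i w k)%N.
Proof. by rewrite /ell; case: eqP => // _; rewrite leq_maxl. Qed.

Lemma ell_le n i (w : 'S_n.+1) k : (i <= n)%N -> (ell i w k <= n)%N.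
Proof.
move=> le_in; rewrite /ell; case: eqP => [_|_]; first lia.
rewrite geq_max (leq_trans (leq_pred i)) //=.
by rewrite big_nat_cond; apply/bigmax_leqP_seq=> j _ /andP[/andP[_]].
Qed.

(** If alpha_{k,j} is an inversion of w, then so is alpha_{k',j} for
k <= k' <= i, since w does not decrease from k to k'. *)
Lemma ell_mono n i (w : 'S_n.+1) k k' : w \in min_coset_reps n i ->
  (i <= n)%N -> (1 <= k <= k')%N -> (k' <= i)%N -> (ell i w k <= ell i w k')%N.
Proof.
move=> w_min le_in /andP[k_gt0 le_kk'] le_k'i.
rewrite /ell !gtn_eqF ?(leq_trans k_gt0) // geq_max leq_maxl /=.
rewrite [X in (_ <= X)%N]maxnC leq_max; apply/orP; left.
rewrite [X in (X <= _)%N]big_nat_cond.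
apply/bigmax_leqP_seq => j _ /andP[/andP[le_ij lt_jn] inv_j].
apply: (@leq_bigmax_seq _ _ _ id j); first by rewrite mem_index_iota le_ij.
move: le_kk'; rewrite leq_eqVlt => /predU1P[<- //|lt_kk'].
have hk : (k.-1 < n.+1)%N by lia.
have hk' : (k'.-1 < n.+1)%N by lia.
pose a := Ordinal hk; pose a' := Ordinal hk'; pose b := Ordinal lt_jn.
have def_k : k = a.+1 by rewrite /= prednK.
have def_k' : k' = a'.+1 by rewrite /= prednK //; lia.
move: inv_j; rewrite [in X in X -> _]def_k def_k' -[j]/(val b).
rewrite !inversion_rootE /=; try lia.
move=> /leq_trans-> //; apply/ltnW/(min_coset_rep_incr w_min) => /=; lia.
Qed.

(** * Farkas' lemma *)

Definition dot (R : realFieldType) (N : nat) (u v : 'rV[R]_N) : R :=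
  \sum_a u ord0 a * v ord0 a.

Section Dot.
Variables (R : realFieldType) (N : nat).
Implicit Types u v : 'rV[R]_N.

Lemma dotC u v : dot u v = dot v u.
Proof. by apply: eq_bigr => a _; rewrite mulrC. Qed.

Lemma dotDr u v1 v2 : dot u (v1 + v2) = dot u v1 + dot u v2.
Proof. by rewrite -big_split /=; apply: eq_bigr => a _; rewrite mxE mulrDr. Qed.

Lemma dotZr c u v : dot u (c *: v) = c * dot u v.
Proof. by rewrite mulr_sumr; apply: eq_bigr => a _; rewrite mxE mulrCA. Qed.

Lemma dotBr u v1 v2 : dot u (v1 - v2) = dot u v1 - dot u v2.
Proof. by rewrite dotDr -[- v2]scaleN1r dotZr mulN1r. Qed.

Lemma dotZl c u v : dot (c *: u) v = c * dot u v.
Proof. by rewrite !(dotC _ v) dotZr. Qed.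

Lemma dotBl u1 u2 v : dot (u1 - u2) v = dot u1 v - dot u2 v.
Proof. by rewrite !(dotC _ v) dotBr. Qed.

Lemma dot0r u : dot u 0 = 0.
Proof. by apply: big1 => a _; rewrite mxE mulr0. Qed.

Lemma dot_sumr I (r : seq I) u (v : I -> 'rV[R]_N) :
  dot u (\sum_(a <- r) v a) = \sum_(a <- r) dot u (v a).
Proof. exact: (big_morph _ (dotDr u) (dot0r u)). Qed.

Lemma dot_gt0 u : u != 0 -> 0 < dot u u.
Proof.
move=> /rV0Pn[a ua0]; rewrite /dot (bigD1 a) //= ltr_pwDl //.
  by rewrite -expr2 exprn_even_gt0.
by apply: sumr_ge0 => b _; rewrite -expr2 sqr_ge0.
Qed.

End Dot.

(** Induction on the number of generators.  If a functional s separating b from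
the cone of all generators but v0 is positive on v0, project along v0 onto the
kernel of s: a representation of the projection of b lifts to one of b, the
coefficient of v0 being nonnegative because s is positive on b and nonpositive
on the other generators, and a functional separating the projections lifts to
one that vanishes on v0. *)
Lemma farkas (R : realFieldType) (N m : nat) (v : 'I_m -> 'rV[R]_N)
    (b : 'rV[R]_N) :
  (exists2 c : 'I_m -> R, forall a, 0 <= c a & b = \sum_a c a *: v a) \/
  (exists2 s, forall a, dot s (v a) <= 0 & 0 < dot s b).
Proof.
elim: m v b => [|m IH] v b.
  have [->|b0] := eqVneq b 0; last first.
    by right; exists b; [by case | exact: dot_gt0].
  by left; exists (fun=> 0) => //; rewrite big_ord0.
pose v0 := v ord0; pose v' a := v (lift ord0 a).
pose cons_coef x (c : 'I_m -> R) a :=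
  if unlift ord0 a is Some a' then c a' else x.
have cons_ge0 x c : 0 <= x -> (forall a, 0 <= c a) ->
    forall a, 0 <= cons_coef x c a.
  by move=> x0 c0 a; rewrite /cons_coef; case: unlift.
have cons_sum x c :
    \sum_a cons_coef x c a *: v a = x *: v0 + \sum_a c a *: v' a.
  rewrite big_ord_recl /cons_coef unlift_none; congr (_ + _).
  by apply: eq_bigr => a _; rewrite liftK.
have [[c c0 def_b]|[s sv sb]] := IH v' b.
  left; exists (cons_coef 0 c); first exact: cons_ge0.
  by rewrite cons_sum scale0r add0r.
have [sv0|sv0] := lerP (dot s v0) 0.
  right; exists s => // a.
  by case: (unliftP ord0 a) => [a' ->|->] //; apply: sv.
pose proj u := u - (dot s u / dot s v0) *: v0.
have [[c c0 def_b]|[s' s'v s'b]] := IH (proj \o v') (proj b).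
  left; pose x := dot s b / dot s v0 - \sum_a c a * (dot s (v' a) / dot s v0).
  exists (cons_coef x c).
    apply: cons_ge0 => //; rewrite subr_ge0.
    apply: (@le_trans _ _ 0); last by rewrite divr_ge0 ?ltW.
    by apply: sumr_le0 => a _; rewrite mulr_ge0_le0 ?pmulr_lle0 ?invr_gt0.
  rewrite cons_sum /x; apply/eqP; rewrite -subr_eq0; apply/eqP.
  move/eqP: def_b; rewrite /proj subr_eq => /eqP {1}->.
  under eq_bigr do rewrite /= scalerBr scalerA.
  rewrite big_split /= sumrN -scaler_suml scalerBl.
  rewrite opprD opprB addrACA -addrA [X in X + _]addrC.
  set p := \sum_a _; set q := _ *: v0; set t := _ *: v0.
  by apply/rowP => j; rewrite !mxE; ring.
have projE u : dot (s' - (dot s' v0 / dot s v0) *: s) u = dot s' (proj u).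
  by rewrite /proj dotBr dotZr dotBl dotZl; ring.
right; exists (s' - (dot s' v0 / dot s v0) *: s); last by rewrite projE.
move=> a; case: (unliftP ord0 a) => [a' ->|->].
  by rewrite projE; apply: s'v.
by rewrite dotBl dotZl divfK ?subrr // gt_eqF.
Qed.

(** Homogenisation: apply the conic statement one dimension higher, to (1, y),
the vectors (1, v a) and the extra generator (1, 0), whose coefficient makes up
for a sum of coefficients smaller than 1. *)
Lemma affine_farkas (R : realFieldType) (N m : nat) (v : 'I_m -> 'rV[R]_N)
    (y : 'rV[R]_N) :
  (forall s, (forall a, dot s (v a) <= 1) -> dot s y <= 1) ->
  exists c : 'I_m -> R,
    [/\ forall a, 0 <= c a, \sum_a c a <= 1 & y = \sum_a c a *: v a].
Proof.
move=> y_valid.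
pose lift1 (x : R) (u : 'rV[R]_N) : 'rV[R]_(1 + N) := row_mx x%:M u.
have dot1 (s : 'rV[R]_(1 + N)) x u :
    dot s (lift1 x u) = s ord0 (lshift N ord0) * x + dot (rsubmx s) u.
  rewrite /dot big_split_ord /= big_ord1 row_mxEl !mxE eqxx mulr1n.
  by congr (_ + _); apply: eq_bigr => a _; rewrite row_mxEr !mxE.
have lift1l x u : lift1 x u ord0 (lshift N ord0) = x.
  by rewrite /lift1 row_mxEl mxE eqxx mulr1n.
have lift1r x u j : lift1 x u ord0 (rshift 1 j) = u ord0 j.
  by rewrite /lift1 row_mxEr.
clearbody lift1.
pose v1 (a : 'I_m.+1) := 
  if unlift ord0 a is Some a' then lift1 1 (v a') else lift1 1 0.
have [[c c0 def_y]|[s sv sy]] := farkas v1 (lift1 1 y).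
  exists (fun a => c (lift ord0 a)); split=> //.
    have := congr1 (fun u : 'rV_(1 + N) => u ord0 (lshift N ord0)) def_y.
    rewrite /= summxE big_ord_recl mxE /v1 unlift_none !lift1l mulr1 => ->.
    rewrite -[X in X <= _]add0r lerD // ler_sum // => a _.
    by rewrite liftK mxE lift1l mulr1.
  apply/rowP => j.
  have := congr1 (fun u : 'rV_(1 + N) => u ord0 (rshift 1 j)) def_y.
  rewrite /= summxE big_ord_recl mxE /v1 unlift_none !lift1r mxE mulr0 add0r.
  move=> ->.
  by rewrite summxE; apply: eq_bigr => a _; rewrite liftK !mxE lift1r.
exfalso; move: sy; rewrite dot1 mulr1.
set x := s _ _ ; set s' := rsubmx s => sy.
have sv' a : x + dot s' (v a) <= 0.
  by have := sv (lift ord0 a); rewrite /v1 liftK dot1 mulr1.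
have x_le0 : x <= 0.
  by have := sv ord0; rewrite /v1 unlift_none dot1 dot0r mulr1 addr0.
(* With x := s_0 <= 0 one has <s', v a> <= -x < <s', y>; the rescaled s' is at
   most 1 on all v a and larger than 1 on y, whether or not x is 0. *)
have y1 := @y_valid ((dot s' y - x)^-1 *+ 2 *: s').
have d_gt0 : 0 < dot s' y - x by lra.
have /y1 : forall a, dot ((dot s' y - x)^-1 *+ 2 *: s') (v a) <= 1.
  move=> a; rewrite dotZl mulrnAl -mulrnAr mulrC ler_pdivrMr // mul1r.
  have := sv' a; lra.
rewrite dotZl mulrnAl -mulrnAr mulrC ler_pdivrMr // mul1r; lra.
Qed.

(** * Lattice polytopes and reflexive polytopes *)

Lemma sum_option (V : nmodType) (T : finType) (F : option T -> V) :
  \sum_o F o = F None + \sum_t F (Some t).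
Proof.
rewrite (bigD1 None) //= (reindex_omap Some id) //=; last by case.
by congr (_ + _); apply: eq_bigl => t; rewrite eqxx.
Qed.

Section Polytopes.
Variables (R : realType) (N : nat).
Implicit Types (A : set 'rV[R]_N) (s u : 'rV[R]_N).

Definition conv_closed A : Prop :=
  forall m (v : 'I_m -> 'rV[R]_N),
    (forall a, A (v a)) -> forall s, conv_hull v s -> A s.

Lemma weighted_sum_le m (c f : 'I_m -> R) (b : R) :
  (forall a, 0 <= c a) -> \sum_a c a = 1 -> (forall a, f a <= b) ->
  \sum_a c a * f a <= b.
Proof.
move=> c0 c1 fb; rewrite -[b]mul1r -c1 mulr_suml.
by apply: ler_sum => a _; rewrite ler_wpM2l.
Qed.

Lemma conv_hull_vertex m (v : 'I_m -> 'rV[R]_N) a : conv_hull v (v a).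
Proof.
exists (fun a' => (a' == a)%:R); split=> [a'||]; first by rewrite ler0n.
  by rewrite (bigD1 a) //= eqxx big1 ?addr0 // => a' /negPf->.
rewrite (bigD1 a) //= eqxx scale1r big1 ?addr0 // => a' /negPf->.
by rewrite scale0r.
Qed.

(** The vertices may be indexed by the elements of Q in any finite type, as is
convenient for sets of elements of a poset. *)
Lemma lattice_polytopeI A (T : finType) (Q : {pred T}) (z : T -> 'rV[int]_N) :
  conv_closed A -> (forall t, t \in Q -> A (lattice_pt R (z t))) ->
  (forall s, A s -> exists c : T -> R,
     [/\ forall t, 0 <= c t, \sum_(t in Q) c t = 1
       & s = \sum_(t in Q) c t *: lattice_pt R (z t)]) ->
  lattice_polytope A.
Proof.
move=> convA zA decA; exists #|Q|, (z \o enum_val); apply/seteqP; split=> s.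
  move=> /decA[c [c0 c1 ->]]; exists (c \o enum_val).
  split=> [a||]; first exact: c0; first by rewrite -c1 [RHS]big_enum_val.
  by rewrite big_enum_val.
by apply: convA => a; apply: zA; apply: enum_valP.
Qed.

(** Bipolar theorem for finitely many half-spaces; the origin, here the image of
None, has to be added to the normal vectors. *)
Lemma polar_dual_lattice (T : finType) (a : T -> 'rV[int]_N) :
  lattice_polytope
    (polar_dual [set s | forall t, dot s (lattice_pt R (a t)) <= 1]%classic).
Proof.
pose z o := if o is Some t then a t else 0.
apply: (@lattice_polytopeI _ _ predT z).
- move=> m v vA s [c [c0 c1 ->]] x Ax; rewrite -/(dot _ _) dot_sumr.
  under eq_bigr do rewrite dotZr.
  by apply: weighted_sum_le => // j; apply: vA.
- move=> [t|] _ s As /=; first exact: As.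
  by rewrite -/(dot _ _) /lattice_pt map_mx0 dot0r.
move=> y Ay.
pose v (i : 'I_#|T|) := lattice_pt R (a (enum_val i)).
have [|c [c0 c1 ->]] := @affine_farkas _ _ _ v y.
  by move=> s As; apply: Ay => t; rewrite -(enum_rankK t); apply: As.
exists (fun o => if o is Some t then c (enum_rank t) else 1 - \sum_i c i).
split=> [[t|]//||]; first by rewrite subr_ge0.
  rewrite sum_option /= (reindex _ (onW_bij _ (@enum_rank_bij T))) /=.
  by rewrite subrK.
rewrite sum_option /= /lattice_pt map_mx0 scaler0 add0r.
rewrite (reindex _ (onW_bij _ (@enum_rank_bij T))) /=.
by apply: eq_bigr => t _; rewrite /v enum_rankK.
Qed.

Lemma halfspaces_interior0 (T : finType) (a : T -> 'rV[R]_N) :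
  interior [set s | forall t, dot s (a t) <= 1]%classic 0.
Proof.
pose M := \sum_t \sum_i `|a t ord0 i|.
have M0 : 0 <= M by do 2!apply: sumr_ge0 => ? _.
have M1 : 0 < 1 + M by rewrite ltr_pwDl.
apply/nbhs_ballP; exists (1 + M)^-1; first by rewrite /= invr_gt0.
move=> s s_small t.
have s_le i : `|s ord0 i| <= (1 + M)^-1.
  have [_ /(_ ord0 i)] := s_small; rewrite /ball /= mxE sub0r normrN.
  exact: ltW.
apply: (@le_trans _ _ ((1 + M)^-1 * \sum_i `|a t ord0 i|)).
  rewrite mulr_sumr; apply: ler_sum => i _.
  by rewrite (le_trans (ler_norm _)) // normrM ler_wpM2r.
rewrite mulrC ler_pdivrMr // mul1r (@le_trans _ _ M) ?lerDr //.
rewrite /M (bigD1 t) //= lerDl; apply: sumr_ge0 => t' _.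
by apply: sumr_ge0.
Qed.

Lemma interior0_scale A u : interior A 0 -> exists2 e : R, 0 < e & A (e *: u).
Proof.
move=> /nbhs_ballP[e /= e0 eA].
pose M := \sum_i `|u ord0 i|.
have M0 : 0 <= M by apply: sumr_ge0 => ? _.
have M1 : 0 < 1 + M by rewrite ltr_pwDl.
exists (e / (1 + M)); first by rewrite divr_gt0.
apply: eA; split=> // k i; rewrite /ball /= !mxE sub0r normrN normrM ord1.
rewrite ger0_norm ?divr_ge0 ?ltW // mulrAC ltr_pdivrMr // ltr_pM2l //.
rewrite ltr_pwDl // /M (bigD1 i) //= lerDl; exact: sumr_ge0.
Qed.

(** The functional a / b is a convex combination of the lattice points that span
the polar dual, and those of positive weight are 1 wherever a takes the value b.
By the last hypothesis, which holds if the latter points form a facet and a is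
primitive, such a lattice point is d *: a with d an integer, so d * b = 1. *)
Lemma reflexive_facet A (a : 'rV[int]_N) (b : int) :
  reflexive_polytope A -> a != 0 ->
  (forall s, A s -> dot s (lattice_pt R a) <= b%:~R) ->
  (exists2 s, A s & dot s (lattice_pt R a) = b%:~R) ->
  (forall v : 'rV[int]_N,
     (forall s, A s -> dot s (lattice_pt R a) = b%:~R ->
        dot s (lattice_pt R v) = 1) ->
     exists c, v = c *: a) ->
  b = 1.
Proof.
case=> _ int0 [m [z polarE]] a0 aA [s0 As0 tight0] facet.
have a0' : lattice_pt R a != 0.
  apply: contraNneq a0 => /rowP a0; apply/eqP/rowP => k.
  by have /eqP := a0 k; rewrite !mxE intr_eq0 => /eqP.
have b_gt0 : 0 < b.
  have [e e0 /aA] := interior0_scale (lattice_pt R a) int0.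
  rewrite dotZl -(ltr0z R); apply: lt_le_trans.
  by rewrite mulr_gt0 ?dot_gt0.
have b_gt0' : 0 < b%:~R :> R by rewrite ltr0z.
have : polar_dual A ((b%:~R)^-1 *: lattice_pt R a).
  move=> s As; rewrite -/(dot _ _) dotZr mulrC ler_pdivrMr // mul1r; exact: aA.
rewrite polarE => -[c [c0 c1 def_ab]].
have [j cj|c_le0] := pickP (fun j => 0 < c j); last first.
  exfalso; move/eqP: c1; rewrite big1 1?eq_sym ?oner_eq0 // => k _.
  by apply/eqP; rewrite eq_le c0 leNgt c_le0.
have tight_z s : A s -> dot s (lattice_pt R a) = b%:~R ->
    dot s (lattice_pt R (z j)) = 1.
  move=> As tight_s.
  have z_le1 k : dot s (lattice_pt R (z k)) <= 1.
    have /(_ s As) : polar_dual A (lattice_pt R (z k)).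
      rewrite polarE.
      exact: (conv_hull_vertex (fun k => lattice_pt R (z k))).
    by [].
  have sum0 : \sum_k c k * (1 - dot s (lattice_pt R (z k))) = 0.
    under eq_bigr do rewrite mulrBr mulr1.
    rewrite big_split /= sumrN c1; apply/eqP; rewrite subr_eq0 eq_sym.
    under eq_bigr do rewrite -dotZr.
    by rewrite -dot_sumr -def_ab dotZr tight_s mulVf // gt_eqF.
  have /psumr_eq0P/(_ sum0)/(_ j isT)/eqP : forall k, true ->
      0 <= c k * (1 - dot s (lattice_pt R (z k))).
    by move=> k _; rewrite mulr_ge0 // subr_ge0.
  by rewrite mulf_eq0 gt_eqF //= subr_eq0 => /eqP.
have [d def_z] := facet _ tight_z.
have := tight_z _ As0 tight0.
have -> : lattice_pt R (z j) = d%:~R *: lattice_pt R a.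
  by apply/rowP => k; rewrite def_z !mxE intrM.
rewrite dotZr tight0 -intrM => /eqP; rewrite -[1]/(1%:~R) eqr_int => /eqP.
by move/(congr1 absz)/eqP; rewrite abszM muln_eq1 => /andP[_]; lia.
Qed.

End Polytopes.

(** * Polytopes with coordinates indexed by a finite type *)

Lemma sum_delta (V : pzSemiRingType) (T : finType) (Q : {pred T}) (t : T)
    (f : T -> V) :
  t \in Q -> \sum_(u in Q) f u * (u == t)%:R = f t.
Proof.
move=> Qt; rewrite (bigD1 t) //= eqxx mulr1 big1 ?addr0 //.
move=> u /andP[_ /negPf->].
by rewrite mulr0.
Qed.

Lemma sum_set_delta (T : finType) (F : {set T}) (t : T) :
  \sum_(u in F) (u == t)%:R = (t \in F)%:R :> int.
Proof.
case: (boolP (t \in F)) => [Ft|F't].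
  rewrite -[RHS](@sum_delta _ _ [in F] t (fun=> 1)) //.
  by under [RHS]eq_bigr do rewrite mul1r.
by apply: big1 => u Fu; case: eqP => // u_t; rewrite -u_t Fu in F't.
Qed.

Section Coordinates.
Variable P : finType.

Definition vec (T : Type) (f : P -> T) : 'rV[T]_#|P| := \row_a f (enum_val a).

Definition indicator (F : {set P}) : 'rV[int]_#|P| :=
  vec (fun x => (x \in F)%:R).

Lemma coord_vec T (f : P -> T) x : coord (vec f) x = f x.
Proof. by rewrite /coord mxE enum_rankK. Qed.

Lemma coord_inj T (u v : 'rV[T]_#|P|) : coord u =1 coord v -> u = v.
Proof.
move=> uv; apply/rowP => a; have := uv (enum_val a).
by rewrite /coord enum_valK.
Qed.

Lemma coord_lattice (R : realType) (z : 'rV[int]_#|P|) x :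
  coord (lattice_pt R z) x = (coord z x)%:~R.
Proof. by rewrite /coord mxE. Qed.

Lemma coord_indicator (R : realType) F x :
  coord (lattice_pt R (indicator F)) x = (x \in F)%:R.
Proof. by rewrite coord_lattice coord_vec; case: (x \in F). Qed.

Lemma coord_comb (R : realType) I (r : seq I) (Q : pred I) (c : I -> R)
    (v : I -> 'rV[R]_#|P|) x :
  coord (\sum_(a <- r | Q a) c a *: v a) x =
  \sum_(a <- r | Q a) c a * coord (v a) x.
Proof. by rewrite /coord summxE; apply: eq_bigr => a _; rewrite mxE. Qed.

Lemma coord_affine (R : realType) (c : R) (s t : 'rV[R]_#|P|) x :
  coord (c *: s + t) x = c * coord s x + coord t x.
Proof. by rewrite /coord !mxE. Qed.

Lemma dot_coord (R : realType) (u v : 'rV[R]_#|P|) :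
  dot u v = \sum_x coord u x * coord v x.
Proof. by rewrite /dot (reindex _ (onW_bij _ (@enum_rank_bij P))). Qed.

Variable R : realType.

(** A lattice polytope is Gorenstein if a dilation and a translation turn the
right hand sides of all its integral inequalities into 1. *)
Lemma gorensteinI (S : set 'rV[R]_#|P|) (m : nat) (z : P -> int)
    (T : finType) (a : T -> P -> int) :
  (0 < m)%N -> lattice_polytope S ->
  (forall s, S s <-> forall t,
     \sum_x (m%:R * coord s x + (z x)%:~R) * (a t x)%:~R <= 1) ->
  gorenstein S.
Proof.
move=> m0 latS SP; split=> //; exists m, (vec z); split=> //.
set A := image _ _.
have m0' : m%:R != 0 :> R by rewrite pnatr_eq0 -lt0n.
have dotE s t :
    dot (m%:R *: s + lattice_pt R (vec z)) (lattice_pt R (vec (a t))) =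
    \sum_x (m%:R * coord s x + (z x)%:~R) * (a t x)%:~R.
  rewrite dot_coord; apply: eq_bigr => x _.
  by rewrite coord_affine !coord_lattice !coord_vec.
have AE : A = [set s | forall t, dot s (lattice_pt R (vec (a t))) <= 1]%classic.
  apply/seteqP; split=> [_ [s /SP Ss <-] t|s As]; first by rewrite dotE.
  pose s' := m%:R^-1 *: (s - lattice_pt R (vec z)).
  have def_s : m%:R *: s' + lattice_pt R (vec z) = s.
    by rewrite scalerA mulfV // scale1r subrK.
  exists s' => //; apply/SP => t; rewrite -dotE def_s; exact: As.
split; last by rewrite AE; apply: polar_dual_lattice.
  have [k [v defS]] := latS; exists k, (fun b => m%:Z *: v b + vec z).
  have vE b : lattice_pt R (m%:Z *: v b + vec z) =
      m%:R *: lattice_pt R (v b) + lattice_pt R (vec z).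
    by apply/rowP => j; rewrite !mxE intrD intrM; congr (_ * _ + _).
  have combE (c : 'I_k -> R) : \sum_b c b = 1 ->
      \sum_b c b *: lattice_pt R (m%:Z *: v b + vec z) =
      m%:R *: (\sum_b c b *: lattice_pt R (v b)) + lattice_pt R (vec z).
    move=> c1; under eq_bigr do rewrite vE scalerDr scalerA mulrC -scalerA.
    by rewrite big_split /= -scaler_sumr -scaler_suml c1 scale1r.
  rewrite /A defS; apply/seteqP; split.
    move=> _ [_ [c [c0 c1 ->]] <-].
    by exists c; split=> //; rewrite combE.
  move=> _ [c [c0 c1 ->]].
  by exists (\sum_b c b *: lattice_pt R (v b)); [exists c | rewrite combE].
by rewrite AE; apply: halfspaces_interior0.
Qed.

(** Facets at lattice distance one, expressed before dilation and translation:
the facet is the set of points of S where a takes the value b, and its vertices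
are indicators of subsets.  A functional that takes one value k on all these
vertices must be a multiple of a for a to define a facet. *)
Lemma gorenstein_facet (S : set 'rV[R]_#|P|) (m : nat) (z : 'rV[int]_#|P|)
    (a : P -> int) (b : int) :
  (0 < m)%N ->
  reflexive_polytope [set m%:R *: s + lattice_pt R z | s in S]%classic ->
  (exists x, a x != 0) ->
  (forall s, S s -> \sum_x coord s x * (a x)%:~R <= b%:~R) ->
  (exists2 F, S (lattice_pt R (indicator F)) & \sum_(x in F) a x = b) ->
  (forall (v : P -> int) k,
     (forall F, S (lattice_pt R (indicator F)) -> \sum_(x in F) a x = b ->
        \sum_(x in F) v x = k) ->
     exists c, forall x, v x = c * a x) ->
  m%:Z * b + \sum_x coord z x * a x = 1.
Proof.
move=> m0 reflA [x0 ax0] aS [F0 SF0 tightF0] facet.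
have dotE s (v : P -> int) :
    dot (m%:R *: s + lattice_pt R z) (lattice_pt R (vec v)) =
    m%:R * (\sum_x coord s x * (v x)%:~R) + (\sum_x coord z x * v x)%:~R.
  rewrite dot_coord rmorph_sum /= mulr_sumr -big_split /=.
  apply: eq_bigr => x _.
  by rewrite coord_affine !coord_lattice coord_vec mulrDl mulrA intrM.
have indE F (v : P -> int) :
    \sum_x coord (lattice_pt R (indicator F)) x * (v x)%:~R =
    (\sum_(x in F) v x)%:~R.
  rewrite rmorph_sum /= [RHS]big_mkcond /=; apply: eq_bigr => x _.
  by rewrite coord_indicator; case: (x \in F); rewrite ?mul1r ?mul0r.
have dotE' F (v : P -> int) :
    dot (m%:R *: lattice_pt R (indicator F) + lattice_pt R z)
        (lattice_pt R (vec v)) =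
    (m%:Z * (\sum_(x in F) v x) + \sum_x coord z x * v x)%:~R.
  by rewrite dotE indE intrD intrM.
apply: (reflexive_facet reflA (a := vec a)).
- apply: contraNneq ax0 => /(congr1 (fun u => coord u x0)).
  by rewrite coord_vec /coord mxE => ->.
- move=> _ [s Ss <-]; rewrite dotE intrD intrM lerD2r ler_wpM2l //; exact: aS.
- exists (m%:R *: lattice_pt R (indicator F0) + lattice_pt R z).
    by exists (lattice_pt R (indicator F0)).
  by rewrite dotE' tightF0.
move=> v v_tight.
have vecK : v = vec (coord v) by apply: coord_inj => x; rewrite coord_vec.
pose k := \sum_(x in F0) coord v x.
have [F SF tightF|c vE] := facet (coord v) k; last first.
  by exists c; apply: coord_inj => x; rewrite vE /coord !mxE enum_rankK.
have one G : S (lattice_pt R (indicator G)) -> \sum_(x in G) a x = b ->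
    m%:Z * (\sum_(x in G) coord v x) + \sum_x coord z x * coord v x = 1.
  move=> SG tightG; apply: (@intr_inj R); rewrite -dotE' -vecK.
  apply: v_tight; last by rewrite dotE' tightG.
  by exists (lattice_pt R (indicator G)).
have m0' : m%:Z != 0 by rewrite eqz_nat -lt0n.
apply: (mulfI m0'); apply: (addIr (\sum_x coord z x * coord v x)).
by rewrite /k !one.
Qed.

(** K describes the dilates of a polytope by a factor M.  Subtracting from s the
indicator of a subset F of its support, multiplied by a value e of s on F, makes
the support smaller, so the induction is on the size of the support. *)
Lemma decompose_by_peeling (K : (P -> R) -> R -> Prop) (Q : {pred {set P}}) :
  set0 \in Q -> (forall s M, K s M -> 0 <= M) ->
  (forall s M, K s M -> (exists x, s x != 0) ->
     exists F e, [/\ F \in Q, 0 <= e,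
       K (fun x => s x - e * (x \in F)%:R) (M - e),
       forall x, x \in F -> s x != 0 & exists2 x, x \in F & s x = e]) ->
  forall s M, K s M ->
  exists c : {set P} -> R,
    [/\ forall F, 0 <= c F, \sum_(F in Q) c F = M
      & forall x, s x = \sum_(F in Q) c F * (x \in F)%:R].
Proof.
move=> Q0 K0 Kstep s M; have [n] := ubnP #|[set x | s x != 0]|.
elim: n s M => // n IH s M lt_n KsM.
have [x0 sx0|s0] := pickP (fun x => s x != 0); last first.
  exists (fun F => M * (F == set0)%:R); split=> [F||x].
  - by rewrite mulr_ge0 ?(K0 _ _ KsM).
  - exact: (@sum_delta _ _ _ _ (fun=> M)).
  rewrite big1 => [|F _]; first by apply/eqP; rewrite -[_ == _]negbK s0.
  by case: eqP => [->|_]; rewrite ?inE ?mulr0 ?mul0r.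
have [F [e [QF e0 KsF Fs [x1 Fx1 sx1]]]] := Kstep _ _ KsM (ex_intro _ x0 sx0).
have [|c [c0 cM cs]] := IH _ _ _ KsF.
  rewrite ltnS in lt_n; apply: leq_trans lt_n; apply: proper_card.
  apply/properP; split.
    apply/fintype.subsetP => x; rewrite !inE.
    case: (boolP (x \in F)) => [/Fs //|_].
    by rewrite mulr0 subr0.
  by exists x1; rewrite !inE ?Fs // Fx1 mulr1 sx1 subrr eqxx.
exists (fun G => c G + e * (G == F)%:R); split=> [G||x].
- by rewrite addr_ge0 // mulr_ge0.
- by rewrite big_split /= cM (@sum_delta _ _ _ _ (fun=> e)) // subrK.
under eq_bigr do rewrite mulrDl mulrAC.
rewrite big_split /= -cs.
rewrite (@sum_delta _ _ _ _ (fun G : {set P} => e * (x \in G)%:R)) //.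
by rewrite subrK.
Qed.

End Coordinates.

(** * Order and chain polytopes are lattice polytopes *)

Section Posets.
Variables (d : Order.disp_t) (P : finPOrderType d).
Implicit Types (x y z : P) (F : {set P}).

Definition minimal x := [forall y : P, ~~ (y < x)%O].
Definition maximal x := [forall y : P, ~~ (x < y)%O].

Lemma minimalPn x : reflect (exists y, (y < x)%O) (~~ minimal x).
Proof.
apply: (iffP forallPn) => [[y /negPn] | [y lt_yx]]; first by exists y.
by exists y; rewrite negbK.
Qed.

Lemma minimal_eq x y : minimal x -> (y <= x)%O -> y = x.
Proof. by move=> /forallP/(_ y); rewrite le_eqVlt => /negPf-> /orP[/eqP|]. Qed.

Lemma maximal_eq x y : maximal x -> (x <= y)%O -> y = x.
Proof. by move=> /forallP/(_ y); rewrite le_eqVlt => /negPf-> /orP[/eqP|]. Qed.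

(** The number of strictly smaller elements is a strictly increasing function on
a finite poset, so minimising it below x gives a minimal element. *)
Lemma minimal_in_below (Q : pred P) x : Q x ->
  exists y, [/\ Q y, (y <= x)%O & forall z, Q z -> ~~ (z < y)%O].
Proof.
move=> Qx; pose h y := #|[set z : P | (z < y)%O]|.
case: (@arg_minnP _ x [pred y | Q y && (y <= x)%O] h).
  by rewrite /= Qx lexx.
move=> y /= /andP[Qy le_yx] y_min; exists y; split=> // z Qz.
apply/negP => lt_zy; have := y_min z.
rewrite /= Qz (le_trans (ltW lt_zy)) // => /(_ isT).
rewrite leqNgt => /negP; apply.
apply: proper_card; apply/properP.
split; last by exists z; rewrite inE ?lt_zy ?ltxx.
by apply/fintype.subsetP => t; rewrite !inE => /lt_trans; apply.
Qed.

Lemma minimal_below x : exists2 y, minimal y & (y <= x)%O.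
Proof.
have [//|y [_ le_yx y_min]] := @minimal_in_below xpredT x.
by exists y => //; apply/forallP => z; apply: y_min.
Qed.

Lemma maximal_above x : exists2 y, maximal y & (x <= y)%O.
Proof.
pose h y := #|[set z : P | (z < y)%O]|.
case: (@arg_maxnP _ x [pred y | (x <= y)%O] h); first exact: lexx.
move=> y /= le_xy y_max; exists y => //; apply/forallP => z.
apply/negP => lt_yz; have := y_max z (le_trans le_xy (ltW lt_yz)).
rewrite leqNgt => /negP; apply.
apply: proper_card; apply/properP.
split; last by exists y; rewrite inE ?lt_yz ?ltxx.
by apply/fintype.subsetP => t; rewrite !inE => /lt_trans; apply.
Qed.

Definition upset : {pred {set P}} :=
  [pred F : {set P} | [forall x in F, forall y, (x <= y)%O ==> (y \in F)]].

Definition antichain : {pred {set P}} :=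
  [pred F : {set P} | [forall x in F, forall y in F, ~~ (x < y)%O]].

Lemma upsetP F :
  reflect (forall x y, x \in F -> (x <= y)%O -> y \in F) (F \in upset).
Proof.
apply: (iffP forall_inP) => [upF x y Fx le_xy|upF x Fx].
  by have /forallP/(_ y) := upF x Fx; rewrite le_xy.
by apply/forallP => y; apply/implyP; apply: upF.
Qed.

Lemma antichainP F :
  reflect {in F &, forall x y, ~~ (x < y)%O} (F \in antichain).
Proof.
apply: (iffP forall_inP) => [acF x y Fx Fy|acF x Fx].
  by have /forall_inP/(_ y Fy) := acF x Fx.
by apply/forall_inP => y Fy; apply: acF.
Qed.

Lemma upset0 : set0 \in upset.
Proof. by apply/upsetP => x y; rewrite inE. Qed.

Lemma antichain0 : set0 \in antichain.
Proof. by apply/antichainP => x y; rewrite inE. Qed.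

Lemma antichain1 x : [set x]%SET \in antichain.
Proof. by apply/antichainP => y z /set1P-> /set1P->; rewrite ltxx. Qed.

(** Comparing the sums of a functional over the up-sets F and F minus w isolates
its coordinate at w. *)
Lemma upset_D1 F w :
  F \in upset -> (forall u, u \in F -> (u <= w)%O -> u = w) -> F :\ w \in upset.
Proof.
move=> /upsetP upF w_min; apply/upsetP => x y /setD1P[xw Fx] le_xy.
rewrite !inE (upF _ _ Fx le_xy) andbT; apply: contraNneq xw => def_y.
by rewrite (w_min x Fx) ?eqxx // -def_y.
Qed.

Definition up x : {set P} := [set y | (x <= y)%O].

Lemma upset_up x : up x \in upset.
Proof. by apply/upsetP => y z; rewrite !inE; apply: le_trans. Qed.

Lemma upsetU F1 F2 : F1 \in upset -> F2 \in upset -> F1 :|: F2 \in upset.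
Proof.
move=> /upsetP up1 /upsetP up2; apply/upsetP => x y; rewrite !inE.
by case/orP=> [/up1|/up2] h /h ->; rewrite ?orbT.
Qed.

Lemma gt_trans : transitive (>%O : rel P).
Proof. by move=> y x z /[swap]; apply: lt_trans. Qed.

Lemma chain_path_uniq x (c : seq P) : path >%O x c -> uniq (x :: c).
Proof.
by move=> xc; apply: (sorted_uniq gt_trans); rewrite // => y; apply: ltxx.
Qed.

Lemma chain_uniq (c : seq P) : sorted >%O c -> uniq c.
Proof. by case: c => // x c; apply: chain_path_uniq. Qed.

Variable R : realType.

Lemma le_sum_of_mem (c : seq P) (x : P) (s : P -> R) : uniq c -> x \in c ->
  (forall y, 0 <= s y) -> s x <= \sum_(y <- c) s y.
Proof.
by move=> Uc cx s0; rewrite (bigD1_seq x) //= lerDl sumr_ge0.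
Qed.

Lemma indicator_order F : F \in upset ->
  @order_polytope R _ P (lattice_pt R (indicator F)).
Proof.
move=> /upsetP upF; split=> [x|x y lt_yx]; rewrite !coord_indicator.
  by case: (x \in F); rewrite ?lexx ?ler01.
case: (boolP (y \in F)) => [Fy|_]; last by rewrite ler0n.
by rewrite (upF _ _ Fy) // ltW.
Qed.

(** The set peeled off is the whole support, which is an up-set. *)
Lemma order_polytope_lattice : lattice_polytope (@order_polytope R _ P).
Proof.
apply: (@lattice_polytopeI _ _ _ _ upset (@indicator P)).
- move=> m v vO s [c [c0 c1 ->]]; split=> [x|x y lt_yx].
    rewrite coord_comb weighted_sum_le ?andbT // => [|a].
      apply: sumr_ge0 => a _; rewrite mulr_ge0 //.
      by have [/(_ x)/andP[]] := vO a.
    by have [/(_ x)/andP[]] := vO a.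
  rewrite !coord_comb; apply: ler_sum => a _; rewrite ler_wpM2l //.
  by have [_] := vO a; apply.
- exact: indicator_order.
move=> s [s01 s_mono].
pose K (f : P -> R) (M : R) := [/\ 0 <= M, forall x, 0 <= f x <= M &
  forall x y, (x <= y)%O -> f x <= f y].
have Kstep f M : K f M -> (exists x, f x != 0) -> exists F e,
    [/\ F \in upset, 0 <= e, K (fun x => f x - e * (x \in F)%:R) (M - e),
        forall x, x \in F -> f x != 0 & exists2 x, x \in F & f x = e].
  move=> [M0 f0M f_mono] [x0 fx0].
  pose F := [set x | f x != 0].
  have [x1 /= Fx1 x1_min] :=
    Order.TotalTheory.arg_minP f (fx0 : (fun x => f x != 0) x0).
  have f_ge0 x : 0 <= f x by case/andP: (f0M x).
  exists F, (f x1); split=> //; try by move=> x; rewrite inE.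
  + apply/upsetP => x y; rewrite !inE => fx le_xy.
    rewrite gt_eqF //; apply: lt_le_trans (f_mono _ _ le_xy).
    by rewrite lt_def fx f_ge0.
  + have F_ge x : x \in F -> f x1 <= f x by rewrite inE; apply: x1_min.
    have nF x : x \notin F -> f x = 0 by rewrite inE negbK => /eqP.
    split; first by rewrite subr_ge0; case/andP: (f0M x1).
      move=> x; case: (boolP (x \in F)) => [/F_ge le_x|/nF->];
        rewrite ?mulr1 ?mulr0.
        by rewrite subr_ge0 le_x lerD2r; case/andP: (f0M x).
      by rewrite subrr lexx subr_ge0; case/andP: (f0M x1).
    move=> x y le_xy; case: (boolP (x \in F)) => [Fx|/nF->].
      have -> : y \in F.
        move: Fx; rewrite !inE => fx; rewrite gt_eqF //.
        by apply: lt_le_trans (f_mono _ _ le_xy); rewrite lt_def fx f_ge0.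
      by rewrite lerD2r f_mono.
    rewrite mulr0 subrr; case: (boolP (y \in F)) => [/F_ge|_].
      by rewrite mulr1 subr_ge0.
    by rewrite mulr0 subr0 f_ge0.
  + by exists x1; rewrite ?inE.
have K0 f M : K f M -> 0 <= M by case.
have [|c [c0 c1 cs]] :=
  decompose_by_peeling upset0 K0 Kstep (s := coord s) (M := 1).
  by split=> // x y; rewrite le_eqVlt => /predU1P[-> //|]; exact: s_mono.
exists c; split=> //; apply: coord_inj => x; rewrite coord_comb cs.
by apply: eq_bigr => F _; rewrite coord_indicator.
Qed.

(** A chain and an antichain have at most one common element. *)
Lemma sum_chain_antichain (c : seq P) F : sorted >%O c -> F \in antichain ->
  \sum_(x <- c) (x \in F)%:R <= 1 :> R.
Proof.
move=> sort_c /antichainP acF; under eq_bigr do rewrite mulrb.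
rewrite -big_mkcond -big_filter big_const_seq count_predT.
have := sorted_filter gt_trans [in F] sort_c.
have : all [in F] [seq x <- c | x \in F] by rewrite filter_all.
case: [seq x <- c | x \in F] => [|x [|y c']] /=; rewrite ?addr0 ?ler01 ?lexx //.
by case/and3P=> Fx Fy _ /andP[lt_yx]; case/negP: (acF _ _ Fy Fx).
Qed.

Lemma indicator_chain F : F \in antichain ->
  @chain_polytope R _ P (lattice_pt R (indicator F)).
Proof.
move=> acF; split=> [x|c sort_c]; first by rewrite coord_indicator.
by under eq_bigr do rewrite coord_indicator; apply: sum_chain_antichain.
Qed.

(** The set peeled off is the antichain F of the minimal elements of the
support, with the coefficient e := min_F s.  A chain that meets F loses e; one
that does not can be extended downwards by an element of F without leaving the
polytope, so its sum is at most M - e already. *)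
Lemma chain_polytope_lattice : lattice_polytope (@chain_polytope R _ P).
Proof.
apply: (@lattice_polytopeI _ _ _ _ antichain (@indicator P)).
- move=> m v vC s [c [c0 c1 ->]]; split=> [x|l sort_l].
    rewrite coord_comb sumr_ge0 // => a _.
    by rewrite mulr_ge0 //; case: (vC a).
  under eq_bigr do rewrite coord_comb.
  rewrite exchange_big /=; under eq_bigr do rewrite -mulr_sumr.
  by apply: weighted_sum_le => // a; have [_] := vC a; apply.
- exact: indicator_chain.
move=> s [s0 s_chain].
pose K (f : P -> R) (M : R) := (forall x, 0 <= f x) /\
  (forall c, sorted >%O c -> \sum_(x <- c) f x <= M).
have Kstep f M : K f M -> (exists x, f x != 0) -> exists F e,
    [/\ F \in antichain, 0 <= e, K (fun x => f x - e * (x \in F)%:R) (M - e),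
        forall x, x \in F -> f x != 0 & exists2 x, x \in F & f x = e].
  move=> [f0 f_chain] [x0 fx0].
  pose F := [set x | (f x != 0) && [forall y, (f y != 0) ==> ~~ (y < x)%O]].
  have F_below x : f x != 0 -> exists2 y, y \in F & (y <= x)%O.
    move=> /(minimal_in_below (Q := fun x => f x != 0))[y [fy le_yx y_min]].
    exists y => //; rewrite inE fy; apply/forall_inP => z; exact: y_min.
  have [y0 Fy0 _] := F_below _ fx0.
  have [x1 /= Fx1 x1_min] := Order.TotalTheory.arg_minP f (Fy0 : [in F] y0).
  have F_neq0 x : x \in F -> f x != 0 by rewrite inE => /andP[].
  have F_min x y : x \in F -> f y != 0 -> ~~ (y < x)%O.
    by rewrite inE => /andP[_ /forall_inP]; apply.
  exists F, (f x1); split=> //; last by exists x1.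
    by apply/antichainP => x y Fx Fy; rewrite F_min ?F_neq0.
  split=> [x|c sort_c].
    case: (boolP (x \in F)) => [/x1_min|_]; rewrite ?mulr1 ?subr_ge0 //.
    by rewrite mulr0.
  rewrite big_split /= sumrN lerBlDr.
  case: (boolP (has [in F] c)) => [/hasP[x cx Fx]|/hasPn F'c].
    apply: (le_trans (f_chain c sort_c)); rewrite -addrA lerDl addrC subr_ge0.
    rewrite -mulr_sumr ler_peMr //.
    have := le_sum_of_mem (s := fun x => (x \in F)%:R) (chain_uniq sort_c) cx.
    by rewrite Fx; apply.
  rewrite [X in _ <= _ + X]big_seq [X in _ <= _ + X]big1 ?addr0; last first.
    by move=> x /F'c /negPf /= ->; rewrite mulr0.
  rewrite lerBrDr.
  have -> : \sum_(x <- c) f x = \sum_(x <- c | f x != 0) f x.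
    by rewrite [RHS]big_mkcond; apply: eq_bigr => x _; case: eqP.
  rewrite -big_filter.
  have := sorted_filter gt_trans (fun x => f x != 0) sort_c.
  have : {subset [seq x <- c | f x != 0]
            <= [pred x | (f x != 0) && (x \notin F)]}.
    by move=> x; rewrite mem_filter => /andP[fx /F'c Fx]; rewrite inE fx.
  case/lastP: [seq x <- c | f x != 0] => [_ _|c' x c'F sort_c'].
    by rewrite big_nil add0r; have := f_chain [:: x1] isT; rewrite big_seq1.
  have /andP[fx F'x] : (f x != 0) && (x \notin F).
    by apply: (c'F x); rewrite mem_rcons mem_head.
  have [y Fy le_yx] := F_below x fx.
  have lt_yx : (y < x)%O.
    by rewrite lt_neqAle le_yx andbT; apply: contraNneq F'x => <-.
  apply: (@le_trans _ _ (\sum_(z <- rcons c' x) f z + f y)).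
    by rewrite lerD2l x1_min.
  have sort_c'y : sorted >%O (rcons (rcons c' x) y).
    case: c' sort_c' {c'F} => [|h t] sort_c'; first by apply/andP.
    by rewrite /= rcons_path last_rcons; apply/andP.
  by have := f_chain _ sort_c'y; rewrite -[rcons _ y]cats1 big_cat big_seq1.
have K0 f M : K f M -> 0 <= M.
  by case=> _ /(_ [::] isT); rewrite big_nil.
have [|c [c0 c1 cs]] :=
  decompose_by_peeling antichain0 K0 Kstep (s := coord s) (M := 1).
  by split.
exists c; split=> //; apply: coord_inj => x; rewrite coord_comb cs.
by apply: eq_bigr => F _; rewrite coord_indicator.
Qed.

End Posets.

Arguments upset {d P}.
Arguments antichain {d P}.

(** * Gorenstein order and chain polytopes of graded posets *)

Section Graded.
Variables (d : Order.disp_t) (P : finPOrderType d).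
Implicit Types (x y z : P).

(** All saturated chains from a minimal element up to x have r x elements; the
maximal elements may have different ranks, so the poset need not be pure. *)
Definition graded (r : P -> nat) : Prop :=
  [/\ forall x, minimal x -> r x = 1%N,
      forall x y, (x < y)%O -> (r x < r y)%N
    & forall x y, (x < y)%O ->
        exists z, [/\ (x <= z)%O, (z < y)%O & r y = (r z).+1]].

Variables (R : realType) (r : P -> nat).
Hypothesis graded_r : graded r.

Let r_minimal x : minimal x -> r x = 1%N.
Proof. by case: graded_r => h _ _; exact: h. Qed.
Let r_lt x y : (x < y)%O -> (r x < r y)%N.
Proof. by case: graded_r => _ h _; exact: h. Qed.
Let r_cover x y : (x < y)%O ->
  exists z, [/\ (x <= z)%O, (z < y)%O & r y = (r z).+1].
Proof. by case: graded_r => _ _ h; exact: h. Qed.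

Let r_gt0 x : (0 < r x)%N.
Proof.
have [/r_minimal-> //|/minimalPn[y /r_lt]] := boolP (minimal x).
exact: leq_ltn_trans.
Qed.

(** After dilation by L + 1 and translation by - r, the inequalities of the
coverings, of the minimal and of the maximal elements read t_x - t_y <= 1,
- t_x <= 1 and t_x <= 1. *)
Lemma gorenstein_order_of_equirank L : (forall x, maximal x -> r x = L) ->
  gorenstein (@order_polytope R _ P).
Proof.
move=> maxL.
pose a (t : P * P + (P + P)) (u : P) : int :=
  match t with
  | inl (x, y) => if (x < y)%O && (r y == (r x).+1)
                  then (u == x)%:R - (u == y)%:R else 0
  | inr (inl x) => if minimal x then - (u == x)%:R else 0
  | inr (inr x) => if maximal x then (u == x)%:R else 0
  end.
apply: (@gorensteinI P R _ L.+1 (fun x => - (r x)%:Z) _ a) => //.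
  exact: order_polytope_lattice.
move=> s; pose f x : R := L.+1%:R * coord s x + (- (r x)%:Z)%:~R.
have fE x : f x = L.+1%:R * coord s x - (r x)%:R by rewrite /f rmorphN.
have m0 : 0 < L.+1%:R :> R by rewrite ltr0n.
have sumf x : \sum_u f u * (u == x)%:R = f x.
  by rewrite (@sum_delta _ _ predT).
have sum0 : \sum_u f u * 0%:~R = 0 :> R.
  by apply: big1 => u _; rewrite mulr0.
have aE t : \sum_u f u * (a t u)%:~R =
  match t with
  | inl (x, y) => if (x < y)%O && (r y == (r x).+1) then f x - f y else 0
  | inr (inl x) => if minimal x then - f x else 0
  | inr (inr x) => if maximal x then f x else 0
  end.
  have natE (b : bool) : (b%:R : int)%:~R = b%:R :> R by case: b.
  case: t => [[x y]|[x|x]] /=; case: ifP => // _.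
  - under eq_bigr do rewrite rmorphB /= !natE mulrBr.
    by rewrite big_split /= sumrN !sumf.
  - under eq_bigr do rewrite rmorphN /= natE mulrN.
    by rewrite sumrN sumf.
  - by under eq_bigr do rewrite natE; rewrite sumf.
split=> [[s01 s_mono] t|s_facets].
  rewrite aE; case: t => [[x y]|[x|x]].
  - case: ifP => [/andP[lt_xy /eqP r_y]|_]; last exact: ler01.
    rewrite !fE r_y.
    have : L.+1%:R * coord s x <= L.+1%:R * coord s y.
      by rewrite ler_pM2l // s_mono.
    rewrite -[(r x).+1]addn1 natrD; lra.
  - case: ifP => [min_x|_]; last exact: ler01.
    rewrite fE r_minimal //.
    have : 0 <= L.+1%:R * coord s x.
      by rewrite mulr_ge0 //; case/andP: (s01 x).
    lra.
  - case: ifP => [max_x|_]; last exact: ler01.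
    rewrite fE maxL //.
    have : L.+1%:R * coord s x <= L.+1%:R * 1.
      by rewrite ler_pM2l //; case/andP: (s01 x).
    rewrite mulr1 -addn1 natrD; lra.
have s_cover x y : (x < y)%O -> r y = (r x).+1 -> coord s x <= coord s y.
  move=> lt_xy r_y; have := s_facets (inl (x, y)).
  rewrite aE lt_xy r_y eqxx /= !fE r_y -[(r x).+1]addn1 natrD => le1.
  by rewrite -(ler_pM2l m0); lra.
have s_mono y x : (x <= y)%O -> coord s x <= coord s y.
  have [n] := ubnP (r y); elim: n y => // n IH y r_y.
  rewrite le_eqVlt => /predU1P[-> //|lt_xy].
  have [z [le_xz lt_zy def_r]] := r_cover lt_xy.
  apply: le_trans (s_cover _ _ lt_zy def_r).
  by apply: IH => //; rewrite -ltnS -def_r.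
split=> [x|x y /ltW]; last exact: s_mono.
have [y min_y /s_mono] := minimal_below x.
have [z max_z /s_mono] := maximal_above x.
have := s_facets (inr (inl y)); have := s_facets (inr (inr z)).
rewrite !aE min_y max_z !fE (maxL z) // (r_minimal min_y).
move=> le_z le_y le_xz le_yx.
apply/andP; split.
  by apply: le_trans le_yx; rewrite -(pmulr_rge0 _ m0); lra.
apply: (le_trans le_xz); rewrite -(ler_pM2l m0) mulr1 -addn1 natrD.
by move: le_z; rewrite -addn1 natrD; lra.
Qed.

(** The vertices of the facet of a minimal x, of a covering of x by y, and of a
maximal x are the indicators of the up-sets that avoid x, that contain both or
none of x and y, and that contain x, respectively. *)
Lemma equirank_of_gorenstein_order : gorenstein (@order_polytope R _ P) ->
  exists L, forall x, maximal x -> r x = L.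
Proof.
case=> _ [m [z [m0 reflA]]].
have facet := gorenstein_facet m0 reflA.
have sum_z1 x : \sum_u coord z u * (u == x)%:R = coord z x.
  by rewrite (@sum_delta _ _ predT).
have R_delta (f : P -> R) x : \sum_u f u * ((u == x)%:R : int)%:~R = f x.
  rewrite -[RHS](@sum_delta _ _ predT) //; apply: eq_bigr => u _.
  by case: (u == x).
have v_eq0 (v : P -> int) k w (F : {set P}) :
    \sum_(u in F) v u = k -> \sum_(u in F :\ w) v u = k -> w \in F -> v w = 0.
  move=> F_k Fw_k Fw; move: F_k; rewrite (big_setD1 w) //= Fw_k.
  by move/(canRL (addrK k)); rewrite subrr.
(* For w other than x and y, the coordinate at w is isolated by the up-sets up w
   and up w minus w, to which up x is added where x has to be a member. *)
have up_D1 w : up w :\ w \in upset.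
  apply: upset_D1; first exact: upset_up.
  by move=> u; rewrite inE => le_wu le_uw; apply/le_anti/andP.
have in_up w u : (u \in up w) = (w <= u)%O by rewrite inE.
have z_minimal x : minimal x -> coord z x = -1.
  move=> min_x; have := facet (fun u => - (u == x)%:R) 0.
  rewrite mulr0 add0r; under eq_bigr do rewrite mulrN.
  rewrite sumrN sum_z1 => /(_ _ _ _ _)/eqP; rewrite eqr_oppLR => h; apply/eqP/h.
  - by exists x; rewrite eqxx.
  - move=> s [s01 _]; under eq_bigr do rewrite rmorphN mulrN.
    by rewrite sumrN R_delta oppr_le0; case/andP: (s01 x).
  - by exists set0; [apply/indicator_order/upset0 | rewrite big_set0].
  have sumF (F : {set P}) : \sum_(u in F) - (u == x)%:R = - (x \in F)%:R :> int.
    by rewrite sumrN sum_set_delta.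
  move=> v k v_tight; exists (- v x) => w; rewrite mulrNN.
  have [->|wx] := eqVneq w x; first by rewrite mulr1.
  have x'up : x \in up w = false.
    by rewrite in_up; apply: contraNF wx => /(minimal_eq min_x)->.
  rewrite mulr0; apply: (v_eq0 v k w (up w)); last by rewrite in_up.
    by apply: v_tight; [apply/indicator_order/upset_up | rewrite sumF x'up].
  apply: v_tight; first exact/indicator_order.
  by rewrite sumF !inE -in_up x'up andbF.
have z_cover x y : (x < y)%O -> r y = (r x).+1 -> coord z x - coord z y = 1.
  move=> lt_xy r_y; have := facet (fun u => (u == x)%:R - (u == y)%:R) 0.
  rewrite mulr0 add0r; under eq_bigr do rewrite mulrBr.
  rewrite big_split /= sumrN !sum_z1; apply.
  - by exists x; rewrite eqxx (lt_eqF lt_xy).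
  - move=> s [_ s_mono]; under eq_bigr do rewrite rmorphB mulrBr /=.
    by rewrite big_split /= sumrN !R_delta subr_le0 s_mono.
  - by exists set0; [apply/indicator_order/upset0 | rewrite big_set0].
  move=> v k v_tight.
  have sumF (F : {set P}) : F \in upset -> (x \in F) = (y \in F) ->
      \sum_(u in F) v u = k.
    move=> upF xyF; apply: v_tight; first exact: indicator_order.
    by rewrite big_split /= sumrN !sum_set_delta xyF subrr.
  have v0 w : w != x -> w != y -> v w = 0.
    move=> wx wy; have [le_xw|nle_xw] := boolP (x <= w)%O.
      have y'up : (w <= y)%O = false.
        apply/negP => le_wy.
        have /r_lt : (x < w)%O by rewrite lt_neqAle eq_sym wx le_xw.
        have /r_lt : (w < y)%O by rewrite lt_neqAle wy le_wy.
        by rewrite r_y ltnS leqNgt => /negP.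
      have x'up : (w <= x)%O = false.
        by apply/negP => le_wx; rewrite (@le_anti _ _ w x) ?eqxx ?le_wx in wx.
      apply: (v_eq0 v k w (up w)); last by rewrite in_up.
        by apply: sumF; rewrite ?upset_up // !in_up x'up y'up.
      by apply: sumF; rewrite // !inE x'up y'up !andbF.
    have upF : up w :|: up x \in upset by rewrite upsetU ?upset_up.
    apply: (v_eq0 v k w (up w :|: up x)); last by rewrite inE in_up lexx.
      by apply: sumF; rewrite // !inE lexx (ltW lt_xy) !orbT.
    apply: sumF; last first.
      by rewrite !inE lexx (ltW lt_xy) !orbT eq_sym wx eq_sym wy.
    apply: upset_D1 => // u; rewrite !inE => /orP[le_wu|le_xu] le_uw.
      by apply/le_anti/andP.
    by rewrite (le_trans le_xu) in nle_xw.
  have k0 : k = 0.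
    by rewrite -(sumF set0) ?upset0 ?inE // big_set0.
  have vxy : v x + v y = 0.
    have := sumF (up x) (upset_up x); rewrite !in_up lexx (ltW lt_xy) k0.
    move=> /(_ erefl); rewrite (big_setD1 x) ?in_up //=.
    rewrite (big_setD1 y) /=; last first.
      by rewrite !inE (ltW lt_xy) gt_eqF.
    rewrite big1 ?addr0 // => u; rewrite !inE => /and3P[uy ux _]; exact: v0.
  exists (v x) => w; have [->|wx] := eqVneq w x.
    by rewrite lt_eqF // subr0 mulr1.
  have [->|wy] := eqVneq w y; last by rewrite subrr mulr0 v0.
  by rewrite sub0r mulrN1; apply/eqP; rewrite -addr_eq0 addrC vxy.
have z_maximal x : maximal x -> m%:Z + coord z x = 1.
  move=> max_x; have := facet (fun u => (u == x)%:R) 1.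
  rewrite mulr1 sum_z1; apply.
  - by exists x; rewrite eqxx.
  - by move=> s [s01 _]; rewrite R_delta; case/andP: (s01 x).
  - exists (up x); first exact/indicator_order/upset_up.
    by rewrite sum_set_delta in_up lexx.
  move=> v k v_tight; exists (v x) => w.
  have [->|wx] := eqVneq w x; first by rewrite mulr1.
  have upF : up w :|: up x \in upset by rewrite upsetU ?upset_up.
  rewrite mulr0; apply: (v_eq0 v k w (up w :|: up x)).
  - apply: v_tight; first exact/indicator_order.
    by rewrite sum_set_delta !inE lexx orbT.
  - apply: v_tight; last by rewrite sum_set_delta !inE lexx orbT eq_sym wx.
    apply/indicator_order/upset_D1 => // u.
    rewrite !inE => /orP[le_wu|le_xu] le_uw; first by apply/le_anti/andP.
    by rewrite (maximal_eq max_x (le_trans le_xu le_uw)) eqxx in wx.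
  - by rewrite inE in_up lexx.
have zE x : coord z x = - (r x)%:Z.
  have [n] := ubnP (r x); elim: n x => // n IH x r_x.
  have [min_x|/minimalPn[y0 /r_cover[y [_ lt_yx def_r]]]] := boolP (minimal x).
    by rewrite z_minimal // r_minimal.
  have := z_cover _ _ lt_yx def_r; rewrite IH; last by rewrite -ltnS -def_r.
  rewrite def_r; lia.
exists m.-1 => x /z_maximal; rewrite zE; lia.
Qed.

Definition covered_by x y := (y < x)%O && (r x == (r y).+1).

Lemma covered_path_chain x c : path covered_by x c -> path >%O x c.
Proof. by apply: sub_path => y z /andP[]. Qed.

(** Any chain below x is dominated by a saturated one: interpolate lower covers.
Hence only chains of maximal length matter in the chain polytope.  With f = 0
this is also the existence of saturated chains. *)
Lemma saturated_chain (f : P -> R) x c : (forall y, 0 <= f y) ->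
  path >%O x c -> exists c',
    [/\ path covered_by x c', (size c').+1 = r x
      & \sum_(y <- c) f y <= \sum_(y <- c') f y].
Proof.
move=> f0; have [n] := ubnP (r x); elim: n x c => // n IH x c r_x xc.
have step z c1 : (z < x)%O -> r x = (r z).+1 -> path >%O z c1 ->
    \sum_(y <- c) f y <= f z + \sum_(y <- c1) f y ->
    exists c', [/\ path covered_by x c', (size c').+1 = r x
      & \sum_(y <- c) f y <= \sum_(y <- c') f y].
  move=> lt_zx def_r zc1 le_c.
  have [|c' [zc' sz_c' le_c1]] := IH z c1 _ zc1; first by rewrite -ltnS -def_r.
  exists (z :: c'); split; first by rewrite /= zc' /covered_by lt_zx def_r eqxx.
    by rewrite /= sz_c' def_r.
  by rewrite big_cons (le_trans le_c) // lerD2l.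
case: c xc step => [_|y c /= /andP[lt_yx yc]] step.
  have [min_x|/minimalPn[y /r_cover[z [_ lt_zx def_r]]]] := boolP (minimal x).
    by exists [::]; rewrite r_minimal.
  by apply: (step z [::]) => //; rewrite !big_nil addr0.
have [z [le_yz lt_zx def_r]] := r_cover lt_yx.
move: le_yz; rewrite le_eqVlt => /predU1P[y_z|lt_yz].
  by apply: (step y c); rewrite ?y_z // -?y_z // big_cons.
apply: (step z (y :: c)) => //=; last by rewrite lerDr.
by apply/andP.
Qed.

(** Descending along the chain while staying above w cannot go on down to the
minimal element, and w cannot lie strictly between an element and its cover. *)
Lemma saturated_incomparable x c w : path covered_by x c ->
  (size c).+1 = r x -> (w < x)%O -> w \notin x :: c ->
  exists2 t, t \in c & ~~ (w <= t)%O && ~~ (t <= w)%O.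
Proof.
elim: c x => [|y c IH] x /=.
  by move=> _ r_x /r_lt; rewrite -r_x ltnS leqNgt r_gt0.
case/andP=> /andP[lt_yx /eqP def_r] yc; rewrite def_r => -[sz_c] lt_wx.
rewrite inE negb_or => /andP[_ c'w].
have wy : w != y by apply: contraNneq c'w => ->; rewrite mem_head.
have [le_wy|nle_wy] := boolP (w <= y)%O.
  have [|t ct inc_t] := IH y yc sz_c _ c'w; first by rewrite lt_neqAle wy le_wy.
  by exists t; rewrite // inE ct orbT.
have [le_yw|nle_yw] := boolP (y <= w)%O; last first.
  by exists y; rewrite ?mem_head // nle_wy.
have /r_lt : (y < w)%O by rewrite lt_neqAle eq_sym wy le_yw.
by have := r_lt lt_wx; rewrite def_r ltnS => /leq_ltn_trans h /h; rewrite ltnn.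
Qed.

(** The inequalities used are those of the coordinates and of the chains with L
elements; they become - t_x <= 1 and sum_c t <= (L + 1) - L. *)
Lemma gorenstein_chain_of_equirank L : (forall x, maximal x -> r x = L) ->
  gorenstein (@chain_polytope R _ P).
Proof.
move=> maxL.
pose a (t : P + L.-tuple P) (u : P) : int :=
  match t with
  | inl x => - (u == x)%:R
  | inr c => if sorted >%O c then (u \in c)%:R else 0
  end.
apply: (@gorensteinI P R _ L.+1 (fun=> -1) _ a) => //.
  exact: chain_polytope_lattice.
move=> s; pose f x : R := L.+1%:R * coord s x + (-1)%:~R.
have fE x : f x = L.+1%:R * coord s x - 1 by rewrite /f rmorphN.
have m0 : 0 < L.+1%:R :> R by rewrite ltr0n.
have aE t : \sum_u f u * (a t u)%:~R =
  match t with
  | inl x => - f x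
  | inr c => if sorted >%O c
             then L.+1%:R * \sum_(x <- c) coord s x - L%:R else 0
  end.
  have natE (b : bool) : (b%:R : int)%:~R = b%:R :> R by case: b.
  case: t => [x|c] /=.
    under eq_bigr do rewrite rmorphN /= natE mulrN.
    by rewrite sumrN (@sum_delta _ _ predT).
  case: ifP => [/chain_uniq Uc|_]; last first.
    by rewrite big1 // => u _; rewrite mulr0.
  under eq_bigr do rewrite natE mulr_natr mulrb.
  rewrite -big_mkcond -(big_uniq _ Uc) /=.
  under eq_bigr do rewrite fE.
  rewrite big_split /= -mulr_sumr sumrN big_const_seq count_predT.
  by rewrite size_tuple iter_addr_0.
split=> [[s0 s_chain] t|s_facets].
  rewrite aE; case: t => [x|c].
    by rewrite fE opprB lerBlDr lerDl mulr_ge0.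
  case: ifP => [/s_chain le1|_]; last exact: ler01.
  have : L.+1%:R * \sum_(x <- c) coord s x <= L.+1%:R * 1 by rewrite ler_pM2l.
  rewrite mulr1 -[in X in _ <= X -> _]addn1 natrD; lra.
have s0 x : 0 <= coord s x.
  by have := s_facets (inl x); rewrite aE fE opprB lerBlDr lerDl pmulr_rge0.
have top_le1 y c : maximal y -> path >%O y c ->
    coord s y + \sum_(x <- c) coord s x <= 1.
  move=> max_y yc; have [c' [yc' sz_c' le_c]] := saturated_chain s0 yc.
  apply: (@le_trans _ _ (coord s y + \sum_(x <- c') coord s x)).
    by rewrite lerD2l.
  have sz : size (y :: c') == L by rewrite /= sz_c' maxL.
  have := s_facets (inr (Tuple sz)).
  rewrite aE /= covered_path_chain // big_cons => le1.
  rewrite -(ler_pM2l m0) mulr1 -[in X in _ <= X]addn1 natrD; lra.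
split=> // -[_|x c xc]; first by rewrite big_nil ler01.
have [y max_y] := maximal_above x; rewrite le_eqVlt => /predU1P[x_y|lt_xy].
  by rewrite big_cons top_le1 // x_y.
apply: (@le_trans _ _ (coord s y + \sum_(z <- x :: c) coord s z)).
  by rewrite lerDr.
by apply: top_le1 => //=; apply/andP.
Qed.

(** The antichains that meet a maximal chain C are the vertices of its facet.
The singletons in C show that a functional constant on them is constant on C,
and an element w outside C together with an element of C incomparable to w shows
that it vanishes at w. *)
Lemma equirank_of_gorenstein_chain : gorenstein (@chain_polytope R _ P) ->
  exists L, forall x, maximal x -> r x = L.
Proof.
case=> _ [m [z [m0 reflA]]].
have facet := gorenstein_facet m0 reflA.
have R_nat (b : bool) : (b%:R : int)%:~R = b%:R :> R by case: b.
have zE x : coord z x = -1.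
  have := facet (fun u => - (u == x)%:R) 0.
  rewrite mulr0 add0r; under eq_bigr do rewrite mulrN.
  rewrite sumrN (@sum_delta _ _ predT) // => /(_ _ _ _ _)/eqP.
  rewrite eqr_oppLR => h; apply/eqP/h.
  - by exists x; rewrite eqxx.
  - move=> s [s0 _]; under eq_bigr do rewrite rmorphN mulrN /= R_nat.
    by rewrite sumrN (@sum_delta _ _ predT) // oppr_le0.
  - by exists set0; [apply/indicator_chain/antichain0 | rewrite big_set0].
  have sumF (F : {set P}) : \sum_(u in F) - (u == x)%:R = - (x \in F)%:R :> int.
    by rewrite sumrN sum_set_delta.
  move=> v k v_tight; exists (- v x) => w; rewrite mulrNN.
  have [->|wx] := eqVneq w x; first by rewrite mulr1.
  rewrite mulr0; transitivity k.
    rewrite -(big_set1 (+%R) w v) /=; apply: v_tight.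
      exact/indicator_chain/antichain1.
    by rewrite sumF inE eq_sym (negPf wx).
  rewrite -(v_tight set0) ?big_set0 //; exact/indicator_chain/antichain0.
exists m.-1 => x max_x.
have [c [xc sz_c _]] := @saturated_chain (fun=> 0) x [::] (fun=> lexx 0) isT.
have Uc : uniq (x :: c) by apply/chain_path_uniq/covered_path_chain.
have sum_C (V : pzSemiRingType) (f : P -> V) :
    \sum_u f u * (u \in x :: c)%:R = \sum_(u <- x :: c) f u.
  rewrite (big_uniq _ Uc) /= [RHS]big_mkcond; apply: eq_bigr => u _.
  by case: (u \in _); rewrite ?mulr1 ?mulr0.
have := facet (fun u => (u \in x :: c)%:R) 1.
rewrite sum_C mulr1; under eq_bigr do rewrite zE.
rewrite big_const_seq count_predT iter_addr_0 /= sz_c => h.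
suff : m%:Z + -1 *+ r x = 1 by rewrite mulNrn; lia.
apply: h.
- by exists x; rewrite mem_head.
- move=> s [_ s_chain]; under eq_bigr do rewrite R_nat.
  by rewrite sum_C; apply: s_chain; apply: covered_path_chain.
- exists [set x]%SET; first exact/indicator_chain/antichain1.
  by rewrite big_set1 mem_head.
move=> v k v_tight.
have v_C u : u \in x :: c -> v u = k.
  move=> Cu; rewrite -(big_set1 (+%R) u v) /=; apply: v_tight.
    exact/indicator_chain/antichain1.
  by rewrite big_set1 Cu.
exists k => w.
have [/v_C->|C'w] := boolP (w \in x :: c); first by rewrite mulr1.
have [t Ct inc_t] : exists2 t, t \in x :: c & ~~ (w <= t)%O && ~~ (t <= w)%O.
  have [le_wx|nle_wx] := boolP (w <= x)%O.
    have [|t ct inc_t] := saturated_incomparable xc sz_c _ C'w.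
      rewrite lt_neqAle le_wx andbT; apply: contraNneq C'w => ->.
      exact: mem_head.
    by exists t; rewrite // inE ct orbT.
  exists x; rewrite ?mem_head // nle_wx /=.
  by apply: contraNN nle_wx => /(maximal_eq max_x)->.
have wt : w != t by apply: contraNneq C'w => ->.
have ac_wt : [set w; t]%SET \in antichain.
  case/andP: inc_t => nle_wt nle_tw; apply/antichainP => y y'.
  move=> /set2P[]-> /set2P[]->; rewrite ?ltxx //;
    by apply/negP => /ltW; apply/negP.
have := v_tight _ (indicator_chain R ac_wt).
rewrite !big_setU1 ?finset.in_set1 // !big_set1 (negPf C'w) Ct /= add0r.
rewrite (v_C t Ct) mulr0.
by move=> /(_ erefl)/(canRL (addrK k)) ->; rewrite subrr.
Qed.

End Graded.

(** * The poset of a nondecreasing sequence *)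

Section Staircase.
Variables (n i : nat) (l : nat -> nat).
Hypothesis l_le : forall k, (l k <= n)%N.
Hypothesis l_mono :
  forall k k', (1 <= k <= k')%N -> (k' <= i)%N -> (l k <= l k')%N.

Local Notation P := (Pell n i l).
Implicit Types x y : P.

(** The labels (k, j) of the element x_{k,j}. *)
Definition lab_k x : nat := (val x).1.
Definition lab_j x : nat := (val x).2.

Lemma PellP x : [/\ (1 <= lab_k x)%N, (lab_k x <= i)%N,
  (i <= lab_j x)%N & (lab_j x <= l (lab_k x))%N].
Proof.
have /andP[k_gt0 /andP[le_ij le_jl]] := valP x.
by split=> //; rewrite -ltnS ltn_ord.
Qed.

Lemma PellI k j : (1 <= k <= i)%N -> (i <= j <= l k)%N ->
  exists x, lab_k x = k /\ lab_j x = j.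
Proof.
move=> /andP[k_gt0 le_ki] /andP[le_ij le_jl].
have hk : (k < i.+1)%N by [].
have hj : (j < n.+1)%N by rewrite ltnS (leq_trans le_jl).
have hx : (1 <= (Ordinal hk, Ordinal hj).1)%N &&
    (i <= (Ordinal hk, Ordinal hj).2 <= l (Ordinal hk, Ordinal hj).1)%N.
  by rewrite /= k_gt0 le_ij.
by exists (exist _ (Ordinal hk, Ordinal hj) hx).
Qed.

Lemma Pell_leE x y :
  (x <= y)%O = (lab_k y <= lab_k x)%N && (lab_j x <= lab_j y)%N.
Proof. by []. Qed.

Lemma Pell_ltE x y : (x < y)%O =
  [&& (lab_k y <= lab_k x)%N, (lab_j x <= lab_j y)%N
    & (lab_k y < lab_k x)%N || (lab_j x < lab_j y)%N].
Proof. by rewrite lt_leAnge !Pell_leE negb_and -!ltnNge -andbA. Qed.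

Definition rank x : nat := (lab_j x - lab_k x).+1.

(** The lower covers of x_{k,j} are x_{k,j-1} and x_{k+1,j}; the latter exists
because l_k <= l_{k+1}. *)
Lemma rank_graded : graded rank.
Proof.
split=> [x min_x|x y|x y].
- have [k_gt0 le_ki le_ij le_jl] := PellP x.
  have [lt_ki|ge_ki] := ltnP (lab_k x) i.
    have l_S : (l (lab_k x) <= l (lab_k x).+1)%N by apply: l_mono; lia.
    have [||y [cy ry]] := @PellI (lab_k x).+1 (lab_j x); try lia.
    by have /forallP/(_ y) := min_x; rewrite Pell_ltE cy ry; lia.
  have [lt_ij|ge_ij] := ltnP i (lab_j x); last by rewrite /rank; lia.
  have [||y [cy ry]] := @PellI (lab_k x) (lab_j x).-1; try lia.
  by have /forallP/(_ y) := min_x; rewrite Pell_ltE cy ry; lia.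
- have [] := PellP x; have [] := PellP y; rewrite Pell_ltE /rank; lia.
have [k_gt0 le_ki le_ij le_jl] := PellP x.
have [k_gt0' le_ki' le_ij' le_jl'] := PellP y; rewrite Pell_ltE => lt_xy.
have [lt_row|ge_row] := ltnP (lab_j x) (lab_j y).
  have [||z [cz rz]] := @PellI (lab_k y) (lab_j y).-1; try lia.
  by exists z; rewrite Pell_leE Pell_ltE /rank cz rz; split; lia.
have l_S : (l (lab_k y) <= l (lab_k y).+1)%N by apply: l_mono; lia.
have [||z [cz rz]] := @PellI (lab_k y).+1 (lab_j y); try lia.
by exists z; rewrite Pell_leE Pell_ltE /rank cz rz; split; lia.
Qed.

Hypothesis l0 : l 0%N = i.-1.
Hypothesis l_ge : forall k, (i.-1 <= l k)%N.

Lemma maximal_corner x : maximal x ->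
  lab_j x = l (lab_k x) /\ l (lab_k x) <> l (lab_k x).-1.
Proof.
move=> /forallP max_x; have [k_gt0 le_ki le_ij le_jl] := PellP x.
split=> [|l_eq].
  have [lt_jl|ge_jl] := ltnP (lab_j x) (l (lab_k x)); last by lia.
  have [||y [cy ry]] := @PellI (lab_k x) (lab_j x).+1; try lia.
  by have := max_x y; rewrite Pell_ltE cy ry; lia.
have [k1|k_gt1] := leqP (lab_k x) 1.
  have def_k : (lab_k x).-1 = 0%N by lia.
  by move: l_eq; rewrite def_k l0; lia.
have [||y [cy ry]] := @PellI (lab_k x).-1 (lab_j x); try lia.
by have := max_x y; rewrite Pell_ltE cy ry; lia.
Qed.

Lemma corner_maximal k : (1 <= k <= i)%N -> l k <> l k.-1 ->
  exists x, [/\ maximal x, lab_k x = k & lab_j x = l k].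
Proof.
move=> le_ki l_neq.
have l_lt : (l k.-1 < l k)%N.
  rewrite ltn_neqAle eq_sym; apply/andP; split; first exact/eqP.
  have [k1|k_gt1] := leqP k 1; last by apply: l_mono; lia.
  by have -> : k.-1 = 0%N by [lia]; rewrite l0.
have := l_ge k.-1 => l_ge'.
have [||x [cx rx]] := @PellI k (l k); try lia.
exists x; split=> //; apply/forallP => y; rewrite Pell_ltE cx rx.
have [k_gt0' le_ki' le_ij' le_jl'] := PellP y.
have [lt_yk|ge_yk] := ltnP (lab_k y) k.
  have := @l_mono (lab_k y) k.-1; lia.
have [lt_ky|ge_ky] := ltnP k (lab_k y); first lia.
have def_k : lab_k y = k by lia.
rewrite def_k in le_jl' *; lia.
Qed.

Lemma equirank_criterion :
  (exists L, forall x, maximal x -> rank x = L) <->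
  exists K : int, forall j : nat, (1 <= j <= i)%N ->
    (l j)%:Z - j%:Z = K \/ l j = l j.-1.
Proof.
split=> [[L maxL]|[K corner_K]].
  exists (L%:Z - 1) => j le_ji.
  have [->|/eqP l_neq] := eqVneq (l j) (l j.-1); first by right.
  left; have [x [max_x cx rx]] := corner_maximal le_ji l_neq.
  have [] := PellP x; have := maxL x max_x; rewrite /rank cx rx; lia.
exists (absz K).+1 => x max_x; have [k_gt0 le_ki le_ij le_jl] := PellP x.
have [def_j l_neq] := maximal_corner max_x.
have [|def_K|//] := corner_K (lab_k x); first lia.
rewrite /rank; lia.
Qed.
End Staircase.

Theorem corollary5p5 (R : realType) (n i : nat) (hi : (1 <= i <= n)%N)
    (w : 'S_n.+1) (hw : w \in min_coset_reps n i) :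
  let l := ell i w in
  let gorenstein_criterion :=
    exists K : int, forall j : nat, (1 <= j <= i)%N ->
      (l j)%:Z - j%:Z = K \/ l j = l j.-1 in
  (gorenstein (@order_polytope R _ (Pell n i l)) <-> gorenstein_criterion) /\
  (gorenstein (@chain_polytope R _ (Pell n i l)) <-> gorenstein_criterion).
Proof.
move=> l crit; have /andP[_ le_in] := hi.
have l_mono k k' : (1 <= k <= k')%N -> (k' <= i)%N -> (l k <= l k')%N.
  exact: ell_mono.
have l_le k : (l k <= n)%N by apply: ell_le.
have l_ge k : (i.-1 <= l k)%N by apply: ell_ge.
have critP := equirank_criterion l_le l_mono (erefl : l 0%N = i.-1) l_ge.
have gr := rank_graded l_le l_mono.
split; (split; [move=> gor; apply/critP | move/critP=> [L maxL]]).
- exact: equirank_of_gorenstein_order gr gor.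
- exact (gorenstein_order_of_equirank R gr maxL).
- exact: equirank_of_gorenstein_chain gr gor.
- exact (gorenstein_chain_of_equirank R gr maxL).
Qed.
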